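(* There exist a sequence of von Neumann algebras $(\mathcal{M}_j)_{j\in\mathbb{N}}$ and a normal, semi-finite, faithful weight $\varphi$ on the Groh--Raynaud ultraproduct $\mathcal{M}=\prod_{j,\omega}\mathcal{M}_j$ such that $\varphi$ cannot be written as the ultraproduct $(\varphi_j)_\omega$ of normal, semi-finite, faithful weights $\varphi_j$ on the $\mathcal{M}_j$'s.
   Context: $\omega$ is a non-principal ultrafilter on $\mathbb{N}$. Groh--Raynaud ultraproduct: each $\mathcal{M}_j$ is represented on its standard form Hilbert space $\mathcal{H}_j$; a bounded sequence $(x_j)_j$, $x_j\in\mathcal{M}_j$, acts on the Hilbert space ultraproduct $\mathcal{H}=\prod_{j,\omega}\mathcal{H}_j$ by $(x_j)_\omega(\xi_j)_\omega=(x_j\xi_j)_\omega$, and $\mathcal{M}$ is the strong operator closure of all such operators. $\mathcal{M}_\ast=\prod_{j,\omega}(\mathcal{M}_j)_\ast$ (Banach space ultraproduct) via $\langle(\rho_j)_\omega,(x_j)_\omega\rangle=\lim_{j,\omega}\rho_j(x_j)$. Ultraproduct weight: for normal weights $\varphi_j$ on $\mathcal{M}_j$, $(\varphi_j)_\omega:=\sup\{(\rho_j)_\omega\mid\rho_j\in(\mathcal{M}_j)_\ast^+,\ \rho_j\le\varphi_j,\ \|\rho_j\|\text{ bounded in }j\}$, a normal weight on $\mathcal{M}$ (the smallest weight majorizing all these functionals). *)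

(* Defs.v *)
From HB Require Import structures.
From mathcomp Require Import all_boot all_order all_algebra.
From mathcomp Require Import ring lra.
From mathcomp Require Import complex ring_quotient generic_quotient.
From mathcomp Require Import all_classical all_reals all_analysis.

Set Implicit Arguments.
Unset Strict Implicit.
Unset Printing Implicit Defensive.

Import Order.TTheory GRing.Theory Num.Theory Num.Def.
Import numFieldNormedType.Exports.

Local Open Scope classical_set_scope.
Local Open Scope ring_scope.

Section DotNorm.
Variables (C : numClosedFieldType) (V : lmodType C) (d : {dot V for conjC}).

Lemma dotC x y : d x y = (d y x)^*.
Proof. by rewrite hermC expr0 mul1r. Qed.

Lemma dot_cauchy_schwarz x y : `|d x y| ^+ 2 <= d x x * d y y.
Proof.
have [->|y0] := eqVneq y 0; first by rewrite [d x 0]linear0r [d 0 0]linear0r normr0 expr0n mulr0.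
have dy : 0 < d y y by exact: neq0_dnorm_gt0.
have := dnorm_ge0 d (x - (d x y / d y y) *: y).
rewrite dnormB dnormZ linearZr_LR /= rmorphM /= rmorphV ?unitfE ?gt_eqF //=.
have -> : (d y y)^* = d y y by rewrite -dotC.
have -> : `|d x y / d y y| ^+ 2 * d y y = `|d x y| ^+ 2 / d y y.
  by rewrite normf_div expr_div_n (gtr0_norm dy) expr2 -expr2; field; rewrite gt_eqF.
have -> : (d x y)^* / d y y * d x y = `|d x y| ^+ 2 / d y y.
  by rewrite normCK mulrAC [_^* * _]mulrC.
set q := `|d x y| ^+ 2 / d y y.
have q0 : 0 <= q by rewrite divr_ge0 ?exprn_ge0 // ltW.
have -> : q^* = q by exact: geC0_conj.
rewrite -addrA (_ : q - (q + q) = - q); last by ring.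
by rewrite subr_ge0 /q ler_pdivrMr.
Qed.

Definition dot_norm x : C := sqrtC (d x x).

Lemma dot_norm_ge0 x : 0 <= dot_norm x.
Proof. by rewrite sqrtC_ge0 dnorm_ge0. Qed.

Lemma dot_norm_le x y : `|d x y| <= dot_norm x * dot_norm y.
Proof.
rewrite -(ler_pXn2r (n := 2)) ?nnegrE ?mulr_ge0 ?dot_norm_ge0 //.
by rewrite exprMn !sqrtCK dot_cauchy_schwarz.
Qed.

Lemma dot_normD x y : dot_norm (x + y) <= dot_norm x + dot_norm y.
Proof.
rewrite -(ler_pXn2r (n := 2)) ?nnegrE ?addr_ge0 ?dot_norm_ge0 //.
rewrite sqrtCK sqrrD !sqrtCK dnormD [leRHS]addrAC lerD2l.
have := dot_norm_le x y; have := leif_normC_Re_Creal (d x y).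
have -> : d x y + (d x y)^* = 2 * 'Re (d x y).
  by rewrite ReE mulrC mulfVK.
move=> [h _] h'; rewrite -[leRHS]mulr_natl ler_pM2l //.
apply: le_trans h'; apply: le_trans h.
by apply: real_ler_norm; exact: Creal_Re.
Qed.

Lemma dot_normZ a x : dot_norm (a *: x) = `|a| * dot_norm x.
Proof. by rewrite /dot_norm dnormZ rootCMl ?exprn_ge0 // sqrCK. Qed.

Lemma dot_norm0_eq0 x : dot_norm x = 0 -> x = 0.
Proof. by move/eqP; rewrite sqrt_dnorm_eq0 => /eqP. Qed.

(* V with the norm of d *)
Definition dot_space (f : {dot V for conjC}) : Type := V.
HB.instance Definition _ := GRing.Lmodule.on (dot_space d).
HB.instance Definition _ := Lmodule_isNormed.Build C (dot_space d)
  dot_normD dot_normZ dot_norm0_eq0.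

End DotNorm.

Record hilbert (R : realType) := Hilbert {
  hsort :> completeNormedModType R[i] ;
  hdot : {dot hsort for conjC} ;
  hnormE : forall x : hsort, `|x| ^+ 2 = hdot x x }.

Notation "''[' x , y ]" := (hdot _ x%R y%R) : ring_scope.

Definition seq_complete (C : numFieldType) (V : normedModType C) :=
  forall u : nat -> V,
    (forall e : C, 0 < e ->
      exists N, forall m n, (N <= m)%N -> (N <= n)%N -> `|u m - u n| <= e) ->
    exists l : V, forall e : C, 0 < e ->
      exists N, forall n, (N <= n)%N -> `|u n - l| <= e.

Section HilbertOfDot.
Variables (R : realType) (V : lmodType R[i]) (d : {dot V for conjC}).
Hypothesis Vcomplete : seq_complete (dot_space d).

Lemma small_invS (e : R[i]) : 0 < e -> exists n : nat, n.+1%:R^-1 <= e.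
Proof.
move=> e0; have er : (complex.Re e)%:C%C = e by rewrite RRe_real // gtr0_real.
have r0 : 0 < complex.Re e by move: e0; rewrite -{1}er ltcR.
exists (truncn (complex.Re e)^-1).
have h : (complex.Re e)^-1 < (truncn (complex.Re e)^-1).+1%:R.
  exact: truncnS_gt.
rewrite -er -(rmorph_nat (real_complex R)) -fmorphV lecR ltW //.
by rewrite invf_plt ?posrE.
Qed.

Lemma dot_space_cauchy_cvg (F : set_system (dot_space d)) :
  ProperFilter F -> cauchy F -> cvg F.
Proof.
move=> FF /cauchyP Fc.
have [u uP] : {u : nat -> dot_space d & forall n, F (ball (u n) (n.+1%:R^-1 / 2))}.
  apply: (@choice _ _ (fun n x => F (ball x (n.+1%:R^-1 / 2)))) => n.
  by apply: Fc; rewrite divr_gt0 // invr_gt0.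
have uE m n : `|u m - u n| <= m.+1%:R^-1 / 2 + n.+1%:R^-1 / 2.
  have [x [xm xn]] := filter_ex (filterI (uP m) (uP n)).
  move: xm xn; rewrite -!ball_normE /= => xm xn.
  rewrite -(subrKA x) (le_trans (ler_normD _ _)) // lerD ?ltW //.
  by rewrite distrC.
have inv_le (N n : nat) : (N <= n)%N -> n.+1%:R^-1 <= N.+1%:R^-1 :> R[i].
  by move=> h; rewrite lef_pV2 ?posrE // ler_nat.
have [] := @Vcomplete u.
  move=> e e0; have [N hN] := small_invS e0; exists N => m n hm hn.
  apply: le_trans (uE m n) _; apply: le_trans hN.
  rewrite [leRHS]splitr; apply: lerD; rewrite ler_pM2r ?invr_gt0 //; exact: inv_le.
move=> l lP; apply/cvg_ex; exists l; apply/cvgrPdist_lt => e e0.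
have e20 : 0 < e / 2 by rewrite divr_gt0.
have [N hN] := lP _ e20; have [N' hN'] := small_invS e20.
near=> x.
have -> : l - x = (l - u (maxn N N')) + (u (maxn N N') - x) by rewrite subrKA.
rewrite (le_lt_trans (ler_normD _ _)) // [ltRHS]splitr ler_ltD //.
  by rewrite distrC hN // leq_maxl.
have hx : ball (u (maxn N N')) ((maxn N N').+1%:R^-1 / 2) x by near: x; exact: uP.
move: hx; rewrite -ball_normE /= => hx; apply: lt_le_trans hx _.
apply: le_trans (_ : N'.+1%:R^-1 <= _) => //.
apply: le_trans (inv_le _ _ (leq_maxr N N')).
by rewrite ler_pdivrMr // ler_peMr ?invr_ge0 // ler1n.
Unshelve. all: by end_near. Qed.

HB.instance Definition _ :=
  Uniform_isComplete.Build (dot_space d) dot_space_cauchy_cvg.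

Definition dot_space_dot (x y : dot_space d) : R[i] := d x y.

HB.instance Definition _ := isBilinear.Build R[i] (dot_space d) (dot_space d)
  R[i] *%R (conjC \; *%R) dot_space_dot
  (@zmod_morphisml_subproof _ _ _ _ _ _ d)
  (@zmod_morphismr_subproof _ _ _ _ _ _ d)
  (@linearl_subproof _ _ _ _ _ _ d)
  (@linearr_subproof _ _ _ _ _ _ d).
HB.instance Definition _ := isHermitianSesquilinear.Build R[i] (dot_space d)
  false conjC dot_space_dot (@hermitian_subproof _ _ _ _ d).
HB.instance Definition _ := isDotProduct.Build R[i] (dot_space d)
  dot_space_dot (@neq0_dnorm_gt0 _ _ _ d).

Definition hilbert_of_dot : hilbert R :=
  @Hilbert R (dot_space d) dot_space_dot (fun x => sqrtCK (d x x)).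

End HilbertOfDot.
Record free_ultrafilter := FreeUltrafilter {
  fu_sets :> set_system nat ;
  fu_ultra : UltraFilter fu_sets ;
  fu_free : forall n, ~ fu_sets [set n] }.
#[global] Existing Instance fu_ultra.

Section UltraLimit.
Variables (R : realType) (w : free_ultrafilter).
Implicit Types (u v : nat -> R[i]).

Definition ulim u : R[i] := lim ((u : nat -> R[i]^o) @ fu_sets w).

Definition bounded_scal u := exists B : R, forall j, `|u j| <= B%:C%C.

Lemma ulimP u l : ((u : nat -> R[i]^o) @ fu_sets w --> (l : R[i]^o)) -> ulim u = l.
Proof. exact: (@cvg_lim R[i]^o). Qed.

Lemma real_ultra_cvg (u : nat -> R) (B : R) :
  (forall j, `|u j| <= B) -> exists l : R, u @ fu_sets w --> l.
Proof.
move=> uB; have := @segment_compact R (- B) B; rewrite compact_ultra => h.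
have [||l [_ hl]] := h (u @ fu_sets w); last by exists l.
  split; first exact: fmap_proper_filter.
  move=> G PG uG; apply/seteqP; split=> [A GA|]; last exact: uG.
  have [//|wA] := in_ultra_setVsetC (u @^-1` A) (fu_ultra w).
  have /uG GC : (u @ fu_sets w) (~` A) by [].
  by have [x []] := filter_ex (filterI GA GC).
rewrite /fmap /=; apply: (@filterE _ w) => j.
by rewrite /= in_itv /= -ler_norml; exact: uB.
Qed.

Lemma normc_Re_Im (z : R[i]) : `|z| <= (`|complex.Re z| + `|complex.Im z|)%:C%C.
Proof.
case: z => a b /=; rewrite rmorphD /=.
have -> : (a +i* b)%C = a%:C%C + 'i%C * b%:C%C by rewrite [LHS]complexE.
apply: le_trans (ler_normD _ _) _; apply: lerD.
  by rewrite normc_def /= expr0n addr0 sqrtr_sqr.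
rewrite normrM [`|'i%C|]normc_def /= expr0n expr1n add0r sqrtr1 mul1r.
by rewrite normc_def /= expr0n addr0 sqrtr_sqr.
Qed.

Lemma bounded_ultra_cvg u : bounded_scal u ->
  (u : nat -> R[i]^o) @ fu_sets w --> (ulim u : R[i]^o).
Proof.
move=> [B uB].
have ReB j : `|complex.Re (u j)| <= B.
  by rewrite -lecR (le_trans (normc_ge_Re _)).
have ImB j : `|complex.Im (u j)| <= B.
  rewrite -lecR; apply: le_trans (uB j).
  have := normc_ge_Re ('i%C * u j).
  rewrite normrM [`|'i%C|]normc_def /= expr0n expr1n add0r sqrtr1 mul1r.
  by case: (u j) => a b /=; rewrite !mul0r mul1r sub0r normrN.
have [a ha] := real_ultra_cvg ReB; have [b hb] := real_ultra_cvg ImB.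
suff h : (u : nat -> R[i]^o) @ fu_sets w --> ((a +i* b)%C : R[i]^o) by rewrite (ulimP h).
apply/cvgrPdist_le => e e0.
have er : (complex.Re e)%:C%C = e by rewrite RRe_real // gtr0_real.
have r0 : 0 < complex.Re e / 2.
  by rewrite divr_gt0 //; move: e0; rewrite -{1}er ltcR.
move/cvgrPdist_le: ha => /(_ _ r0) ha; move/cvgrPdist_le: hb => /(_ _ r0) hb.
apply: filterS (filterI ha hb) => j [/= h1 h2].
apply: le_trans (normc_Re_Im _) _; rewrite -er lecR.
rewrite [leRHS]splitr; apply: lerD.
  by move: h1; case: (u j).
by move: h2; case: (u j).
Qed.

Lemma ulimD u v : bounded_scal u -> bounded_scal v ->
  ulim (fun j => u j + v j) = ulim u + ulim v.
Proof.
move=> /bounded_ultra_cvg hu /bounded_ultra_cvg hv.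
by apply: ulimP; exact: (cvgD hu hv).
Qed.

Lemma ulimZ a u : bounded_scal u -> ulim (fun j => a * u j) = a * ulim u.
Proof. by move=> /bounded_ultra_cvg hu; apply: ulimP; exact: (cvgZl_tmp hu). Qed.

Lemma ulim_conj u : bounded_scal u -> ulim (fun j => (u j)^*) = (ulim u)^*.
Proof.
move=> /bounded_ultra_cvg /cvgrPdist_le hu; apply: ulimP; apply/cvgrPdist_le.
move=> e e0; apply: filterS (hu e e0) => j /=.
by rewrite -rmorphB norm_conjC.
Qed.

Lemma ulim_real (r : nat -> R) (l : R) : r @ fu_sets w --> l ->
  ulim (fun j => (r j)%:C%C) = l%:C%C.
Proof.
move=> /cvgrPdist_le hr; apply: ulimP; apply/cvgrPdist_le => e e0.
have er : (complex.Re e)%:C%C = e by rewrite RRe_real // gtr0_real.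
have r0 : 0 < complex.Re e by move: e0; rewrite -{1}er ltcR.
apply: filterS (hr _ r0) => j /= hj; rewrite -er -rmorphB.
by rewrite normc_def /= expr0n addr0 sqrtr_sqr lecR.
Qed.

Lemma ulim_ge0 u : bounded_scal u -> (forall j, 0 <= u j) -> 0 <= ulim u.
Proof.
move=> [B uB] u0.
have ur j : (complex.Re (u j))%:C%C = u j by rewrite RRe_real // ger0_real.
have r0 j : 0 <= complex.Re (u j) by rewrite -lecR ur.
have [|l hl] := @real_ultra_cvg (fun j => complex.Re (u j)) B.
  by move=> j; rewrite -lecR (le_trans (normc_ge_Re _)).
have -> : u = fun j => (complex.Re (u j))%:C%C by apply/funext => j; rewrite ur.
rewrite (ulim_real hl) lecR.
rewrite -(cvg_lim (@Rhausdorff R) hl); apply: limr_ge; first by apply/cvg_ex; exists l.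
exact: filterE.
Qed.

End UltraLimit.
Lemma hnorm_dot (R : realType) (H : hilbert R) (x : H) : `|x| = dot_norm (hdot H) x.
Proof. by rewrite /dot_norm -hnormE sqrCK. Qed.

Lemma hilbert_cauchy_schwarz (R : realType) (H : hilbert R) (x y : H) :
  `| '[x, y] | <= `|x| * `|y|.
Proof. by rewrite !hnorm_dot; exact: dot_norm_le. Qed.

Section BoundedSeq.
Variables (R : realType) (H_ : nat -> hilbert R).

Definition bounded_seq (xi : forall j, H_ j) :=
  exists B : R, forall j, `|xi j| <= B%:C%C.

Record bseq := BSeq { bfun :> forall j, H_ j ; bfunP : bounded_seq bfun }.

HB.instance Definition _ := gen_eqMixin bseq.
HB.instance Definition _ := gen_choiceMixin bseq.

Lemma bseqP (x y : bseq) : (forall j, x j = y j) -> x = y.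
Proof.
case: x y => [x xP] [y yP] /= h; have e : x = y by exact: functional_extensionality_dep.
by move: xP; rewrite e => xP; rewrite (Prop_irrelevance xP yP).
Qed.

Lemma bseq0_subproof : bounded_seq (fun=> 0).
Proof. by exists 0 => j; rewrite normr0. Qed.
Lemma bseqN_subproof (x : bseq) : bounded_seq (fun j => - x j).
Proof. by have [B xB] := bfunP x; exists B => j; rewrite normrN. Qed.
Lemma bseqD_subproof (x y : bseq) : bounded_seq (fun j => x j + y j).
Proof.
have [B xB] := bfunP x; have [B' yB] := bfunP y; exists (B + B') => j.
by rewrite rmorphD (le_trans (ler_normD _ _)) // lerD.
Qed.
Lemma bseqZ_subproof (a : R[i]) (x : bseq) : bounded_seq (fun j => a *: x j).
Proof.
have [B xB] := bfunP x; exists (complex.Re `|a| * B) => j.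
have e : (complex.Re `|a|)%:C%C = `|a| by rewrite RRe_real // normr_real.
have -> : (complex.Re `|a| * B)%:C%C = `|a| * B%:C%C by rewrite -e -rmorphM e.
rewrite normrZ; apply: ler_wpM2l; [exact: normr_ge0|exact: xB].
Qed.

Definition bseq0 := BSeq bseq0_subproof.
Definition bseqN x := BSeq (bseqN_subproof x).
Definition bseqD x y := BSeq (bseqD_subproof x y).
Definition bseqZ a x := BSeq (bseqZ_subproof a x).

Lemma bseqDA : associative bseqD.
Proof. by move=> x y z; apply: bseqP => j /=; rewrite addrA. Qed.
Lemma bseqDC : commutative bseqD.
Proof. by move=> x y; apply: bseqP => j /=; rewrite addrC. Qed.
Lemma bseqD0 : left_id bseq0 bseqD.
Proof. by move=> x; apply: bseqP => j /=; rewrite add0r. Qed.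
Lemma bseqDN : left_inverse bseq0 bseqN bseqD.
Proof. by move=> x; apply: bseqP => j /=; rewrite addNr. Qed.

HB.instance Definition _ := GRing.isZmodule.Build bseq bseqDA bseqDC bseqD0 bseqDN.

Lemma bseqZA a b x : bseqZ a (bseqZ b x) = bseqZ (a * b) x.
Proof. by apply: bseqP => j /=; rewrite scalerA. Qed.
Lemma bseqZ1 : left_id 1 bseqZ.
Proof. by move=> x; apply: bseqP => j /=; rewrite scale1r. Qed.
Lemma bseqZDr : right_distributive bseqZ +%R.
Proof. by move=> a x y; apply: bseqP => j /=; rewrite scalerDr. Qed.
Lemma bseqZDl x : {morph bseqZ^~ x : a b / a + b}.
Proof. by move=> a b; apply: bseqP => j /=; rewrite scalerDl. Qed.

HB.instance Definition _ :=
  GRing.Zmodule_isLmodule.Build R[i] bseq bseqZA bseqZ1 bseqZDr bseqZDl.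

Lemma bseqBE (x y : bseq) j : (x - y) j = x j - y j. Proof. by []. Qed.
Lemma bseqDE (x y : bseq) j : (x + y) j = x j + y j. Proof. by []. Qed.
Lemma bseqZE a (x : bseq) j : (a *: x) j = a *: x j. Proof. by []. Qed.

Lemma bounded_norm (x : bseq) : bounded_scal (fun j => `|x j|).
Proof. by have [B xB] := bfunP x; exists B => j; rewrite normr_id. Qed.

Lemma bounded_dot (x y : bseq) : bounded_scal (fun j => '[x j, y j]).
Proof.
have [B xB] := bfunP x; have [B' yB] := bfunP y; exists (B * B') => j.
by rewrite (le_trans (hilbert_cauchy_schwarz _ _)) // rmorphM ler_pM.
Qed.

End BoundedSeq.

Section HilbertUltraproduct.
Variables (R : realType) (w : free_ultrafilter) (H_ : nat -> hilbert R).
Implicit Types (x y z : bseq H_).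

Lemma ulim_squeeze (u v : nat -> R[i]) (B : R) : bounded_scal v -> ulim w v = 0 ->
  (forall j, `|u j| <= B%:C%C * v j) -> ulim w u = 0.
Proof.
move=> bv v0 uv; apply: ulimP; apply/cvgrPdist_le => e e0.
have := @bounded_ultra_cvg _ w _ bv; rewrite v0 => /cvgrPdist_le hv.
have e0' : 0 < e / (`|B%:C%C| + 1) by rewrite divr_gt0 // ltr_wpDl.
apply: filterS (hv _ e0') => j /=; rewrite !sub0r !normrN => h.
apply: (le_trans (uv j)).
have nB : 0 < `|B%:C%C| + 1 :> R[i] by rewrite ltr_wpDl.
have uvn : B%:C%C * v j = `|B%:C%C| * `|v j|.
  by rewrite -normrM ger0_norm // (le_trans _ (uv j)).
rewrite uvn (le_trans (_ : _ <= (`|B%:C%C| + 1) * `|v j|)) //.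
  by rewrite ler_wpM2r // lerDl.
by rewrite mulrC -ler_pdivlMr.
Qed.

Definition null_seq : {pred bseq H_} :=
  fun x => `[< ulim w (fun j => `|x j|) = 0 >].

Lemma null_seqP x : reflect (ulim w (fun j => `|x j|) = 0) (x \in null_seq).
Proof. exact: asboolP. Qed.

Lemma null_seq_zmod_closed : zmod_closed null_seq.
Proof.
split.
  apply/null_seqP/ulimP => /=.
  by under eq_fun do rewrite normr0; exact: cvg_cst.
move=> x y /null_seqP hx /null_seqP hy; apply/null_seqP.
apply: (@ulim_squeeze _ (fun j => `|x j| + `|y j|) 1).
- have [B bx] := bounded_norm x; have [B' bY] := bounded_norm y.
  by exists (B + B') => j; rewrite rmorphD (le_trans (ler_normD _ _)) // lerD.
- by rewrite ulimD ?hx ?hy ?addr0 //; exact: bounded_norm.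
- by move=> j; rewrite mul1r normr_id bseqBE ler_normB.
Qed.

HB.instance Definition _ :=
  GRing.isZmodClosed.Build (bseq H_) null_seq null_seq_zmod_closed.

(* bounded sequences modulo those whose norm tends to 0 along w *)
Definition ultra_space := Quotient.quot null_seq.
HB.instance Definition _ := GRing.Zmodule.on ultra_space.

Definition ucl x : ultra_space := (\pi_(Quotient.quot null_seq)%qT x).

Lemma uclB x y : ucl (x - y) = ucl x - ucl y.
Proof. by rewrite /ucl; rewrite !piE. Qed.

Lemma ucl_surj (k : ultra_space) : exists x, ucl x = k.
Proof. by exists (repr k); exact: reprK. Qed.

Lemma uclP x y : ucl x = ucl y <-> ulim w (fun j => `|x j - y j|) = 0.
Proof.
rewrite /ucl; split => [/eqP|h]; last apply/eqP.
  by rewrite -Quotient.idealrBE => /null_seqP.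
by rewrite -Quotient.idealrBE; apply/null_seqP.
Qed.

Lemma uclD x y : ucl (x + y) = ucl x + ucl y.
Proof. by rewrite /ucl; rewrite !piE. Qed.

Lemma ucl0P x : ucl x = 0 <-> ulim w (fun j => `|x j|) = 0.
Proof.
have -> : 0 = ucl 0 by rewrite /ucl !piE.
rewrite uclP; suff -> : (fun j => `|x j - (0 : bseq H_) j|) = (fun j => `|x j|) by [].
by apply/funext => j; rewrite subr0.
Qed.

Lemma repr_ucl x : ulim w (fun j => `|repr (ucl x) j - x j|) = 0.
Proof. by apply/uclP; rewrite /ucl reprK. Qed.

Definition uscale (a : R[i]) (k : ultra_space) : ultra_space := ucl (a *: repr k).

Lemma uscale_ucl a x : uscale a (ucl x) = ucl (a *: x).
Proof.
apply/uclP; apply: (@ulim_squeeze _ (fun j => `|repr (ucl x) j - x j|) (complex.Re `|a|)).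
- exact: (bounded_norm (repr (ucl x) - x)).
- exact: repr_ucl.
- move=> j; rewrite normr_id !bseqZE -scalerBr normrZ RRe_real //.
Qed.

Lemma uscaleA a b k : uscale a (uscale b k) = uscale (a * b) k.
Proof. by have [x <-] := ucl_surj k; rewrite !uscale_ucl scalerA. Qed.
Lemma uscale1 : left_id 1 uscale.
Proof. by move=> k; have [x <-] := ucl_surj k; rewrite !uscale_ucl scale1r. Qed.
Lemma uscaleDr : right_distributive uscale +%R.
Proof.
move=> a k l; have [x <-] := ucl_surj k; have [y <-] := ucl_surj l.
by rewrite -uclD !uscale_ucl scalerDr uclD.
Qed.
Lemma uscaleDl k : {morph uscale^~ k : a b / a + b}.
Proof.
by move=> a b; have [x <-] := ucl_surj k; rewrite !uscale_ucl scalerDl uclD.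
Qed.

HB.instance Definition _ :=
  GRing.Zmodule_isLmodule.Build R[i] ultra_space uscaleA uscale1 uscaleDr uscaleDl.

Lemma uclZ a x : ucl (a *: x) = a *: ucl x.
Proof. by rewrite -uscale_ucl. Qed.

Definition udot (k l : ultra_space) : R[i] := ulim w (fun j => '[repr k j, repr l j]).

Lemma udot_null_l x y : ucl x = 0 -> ulim w (fun j => '[x j, y j]) = 0.
Proof.
move/ucl0P => x0; have [B yB] := bfunP y.
apply: (@ulim_squeeze _ (fun j => `|x j|) B) => //; first exact: bounded_norm.
by move=> j; rewrite (le_trans (hilbert_cauchy_schwarz _ _)) // mulrC ler_wpM2r.
Qed.

Lemma udot_swap x y :
  ulim w (fun j => '[x j, y j]) = (ulim w (fun j => '[y j, x j]))^*.
Proof.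
rewrite -ulim_conj; last exact: bounded_dot.
by congr (ulim w _); apply/funext => j; rewrite dotC.
Qed.

Lemma ulim_dotBl x x' y : ulim w (fun j => '[(x - x') j, y j]) =
  ulim w (fun j => '[x j, y j]) - ulim w (fun j => '[x' j, y j]).
Proof.
have bN : bounded_scal (fun j => -1 * '[x' j, y j]).
  by have [B hB] := bounded_dot x' y; exists B => j; rewrite mulN1r normrN.
have -> : - ulim w (fun j => '[x' j, y j]) = ulim w (fun j => -1 * '[x' j, y j]).
  by rewrite ulimZ ?mulN1r //; exact: bounded_dot.
rewrite -ulimD //; last exact: bounded_dot.
by congr (ulim w _); apply/funext => j; rewrite bseqBE linearBl mulN1r.
Qed.

Lemma udot_ucl x y : udot (ucl x) (ucl y) = ulim w (fun j => '[x j, y j]).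
Proof.
have hl z z' (t : bseq H_) : ucl z = ucl z' ->
    ulim w (fun j => '[z j, t j]) = ulim w (fun j => '[z' j, t j]).
  move=> e; apply/eqP; rewrite -subr_eq0 -(ulim_dotBl z z' t) udot_null_l //.
  by rewrite uclB e subrr.
rewrite /udot (hl _ x (repr (ucl y))); last by rewrite /ucl reprK.
by rewrite udot_swap (hl _ y x) -?udot_swap // /ucl reprK.
Qed.

Lemma udot_linearl l : GRing.linear_for *%R (udot^~ l).
Proof.
move=> a k k'; have [x <-] := ucl_surj k; have [x' <-] := ucl_surj k'.
have [y <-] := ucl_surj l; rewrite -uclZ -uclD !udot_ucl.
have bZ : bounded_scal (fun j => a * '[x j, y j]).
  have [B hB] := bounded_dot (a *: x) y; exists B => j.
  by rewrite -[_ * _](linearZl_LR (hdot (H_ j))); exact: hB.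
rewrite -ulimZ; last exact: bounded_dot.
rewrite -ulimD //; last exact: bounded_dot.
by congr (ulim w _); apply/funext => j; rewrite bseqDE bseqZE linearDl linearZl_LR.
Qed.

Lemma udot_herm k l : udot k l = (-1) ^+ false * (udot l k)^*.
Proof.
have [x <-] := ucl_surj k; have [y <-] := ucl_surj l.
by rewrite expr0 mul1r !udot_ucl udot_swap.
Qed.

Lemma udot_linearr k : GRing.linear_for (conjC \; *%R) (udot k).
Proof.
have sw k' l' : udot k' l' = (udot l' k')^* by rewrite udot_herm expr0 mul1r.
by move=> a l l'; rewrite sw udot_linearl rmorphD rmorphM /= -!sw.
Qed.

HB.instance Definition _ := bilinear_isBilinear.Build R[i] ultra_space ultra_space
  R[i] *%R (conjC \; *%R) udot (udot_linearl, udot_linearr).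
HB.instance Definition _ := isHermitianSesquilinear.Build R[i] ultra_space
  false conjC udot udot_herm.

Lemma ulim_sqr x : ulim w (fun j => '[x j, x j]) = (ulim w (fun j => `|x j|)) ^+ 2.
Proof.
apply: ulimP; rewrite expr2.
have -> : (fun j => '[x j, x j]) = (fun j => `|x j| * `|x j|).
  by apply/funext => j; rewrite -hnormE expr2.
have h := @bounded_ultra_cvg _ w _ (bounded_norm x).
exact: (cvgZ h h).
Qed.

Lemma ulim_norm_ge0 x : 0 <= ulim w (fun j => `|x j|).
Proof. by apply: ulim_ge0 => //; exact: bounded_norm. Qed.

Lemma udot_gt0 k : k != 0 -> 0 < udot k k.
Proof.
have [x <-] := ucl_surj k => x0; rewrite udot_ucl ulim_sqr.
rewrite exprn_gt0 // lt_def ulim_norm_ge0 andbT.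
by apply: contra x0 => /eqP /ucl0P /eqP.
Qed.

HB.instance Definition _ := isDotProduct.Build R[i] ultra_space udot udot_gt0.

Lemma unorm_ucl x : dot_norm udot (ucl x) = ulim w (fun j => `|x j|).
Proof.
rewrite /dot_norm -[X in sqrtC X]/(udot (ucl x) (ucl x)) udot_ucl ulim_sqr.
by rewrite sqrCK // ulim_norm_ge0.
Qed.

Lemma tail_in_ultra k : fu_sets w [set j | (k <= j)%N].
Proof.
elim: k => [|k ih]; first exact: filterE.
have hk : fu_sets w (~` [set k]).
  by have [/(@fu_free w) //|//] := in_ultra_setVsetC [set k] (fu_ultra w).
apply: filterS (filterI ih hk) => j [/= h1 h2].
by rewrite ltn_neqAle h1 andbT; apply/eqP => e; apply: h2.
Qed.

Lemma unorm_lt x e : ulim w (fun j => `|x j|) < e -> fu_sets w [set j | `|x j| <= e].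
Proof.
move=> h; have /cvgrPdist_lt hl := @bounded_ultra_cvg _ w _ (bounded_norm x).
have d0 : 0 < e - ulim w (fun j => `|x j|) by rewrite subr_gt0.
apply: filterS (hl _ d0) => j /= hj.
rewrite -[leRHS](subrK (ulim w (fun j => `|x j|))).
rewrite -(normr_id (x j)) -[X in `|X|](subrK (ulim w (fun j => `|x j|))).
rewrite (le_trans (ler_normD _ _)) // lerD //; first by rewrite distrC ltW.
by rewrite ger0_norm // ulim_norm_ge0.
Qed.

Lemma unorm_le x e : 0 <= e -> fu_sets w [set j | `|x j| <= e] ->
  ulim w (fun j => `|x j|) <= e.
Proof.
move=> e0 he; rewrite real_leNgt ?ger0_real ?ulim_norm_ge0 //; apply/negP => h.
have /cvgrPdist_lt hl := @bounded_ultra_cvg _ w _ (bounded_norm x).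
have d0 : 0 < ulim w (fun j => `|x j|) - e by rewrite subr_gt0.
have [j [/= h1 h2]] := filter_ex (filterI he (hl _ d0)).
have : ulim w (fun j => `|x j|) < ulim w (fun j => `|x j|).
  rewrite -{1}(ger0_norm (ulim_norm_ge0 x)) -[X in `|X|](subrK `|x j|).
  rewrite (le_lt_trans (ler_normD _ _)) //.
  rewrite -[ltRHS](subrK e) ltr_leD // normr_id.
  exact: h1.
by rewrite ltxx.
Qed.

Lemma telescope_half (V : normedModType R[i]) (z : nat -> V) (k m : nat) :
  (k <= m)%N ->
  (forall i, (k <= i < m)%N -> `|z i.+1 - z i| <= (2^-1) ^+ i) ->
  `|z m - z k| <= 2 * (2^-1) ^+ k - 2 * (2^-1) ^+ m.
Proof.
elim: m => [|m ih].
  by rewrite leqn0 => /eqP -> _; rewrite !subrr normr0.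
rewrite leq_eqVlt => /predU1P[->|km] h; first by rewrite !subrr normr0.
have -> : z m.+1 - z k = (z m.+1 - z m) + (z m - z k) by rewrite subrKA.
rewrite (le_trans (ler_normD _ _)) // exprS mulrA divff // mul1r.
have -> : 2 * (2^-1) ^+ k - (2^-1) ^+ m =
    (2^-1) ^+ m + (2 * (2^-1) ^+ k - 2 * (2^-1) ^+ m) :> R[i] by ring.
apply: lerD; first by apply: h; rewrite -ltnS km leqnn.
apply: ih => [|i /andP[ki im]]; first by rewrite -ltnS.
by apply: h; rewrite ki ltnS ltnW.
Qed.

Fixpoint diag_index (A : nat -> nat -> bool) (j n : nat) : nat :=
  if n is n'.+1 then
    let m := diag_index A j n' in if (m == n') && A n' j then n else m
  else 0.

Lemma diag_indexP (A : nat -> nat -> bool) j n : (diag_index A j n <= n)%N /\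
  (forall i, (i < diag_index A j n)%N -> A i j).
Proof.
elim: n => [|n [ih1 ih2]] //=.
case: ifP => [/andP[/eqP e Aj]|_]; last by split=> //; exact: leqW.
split=> // i; rewrite ltnS leq_eqVlt => /predU1P[->//|h].
by apply: ih2; rewrite e.
Qed.

Lemma diag_index_ge (A : nat -> nat -> bool) j k n : (k <= n)%N -> (forall i, (i < k)%N -> A i j) ->
  (k <= diag_index A j n)%N.
Proof.
elim: n k => [|n ih] k; first by rewrite leqn0 => /eqP ->.
move=> kn h /=; have [e|ne] := eqVneq k n.+1.
  have hn : (n <= diag_index A j n)%N.
    by apply: ih => // i hi; apply: h; rewrite e ltnS ltnW.
  have en : diag_index A j n = n.
    by apply/eqP; rewrite eqn_leq hn (diag_indexP A j n).1.
  by rewrite en eqxx h /= e.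
have hk : (k <= diag_index A j n)%N by apply: ih => //; rewrite -ltnS ltn_neqAle ne.
by case: ifP => // _; apply: leq_trans kn _.
Qed.

Lemma ultra_space_fast (z : nat -> bseq H_) :
  (forall i, ulim w (fun j => `|(z i.+1 - z i) j|) < (2^-1) ^+ i) ->
  exists y, forall k, ulim w (fun j => `|(z k - y) j|) <= 2 * (2^-1) ^+ k.
Proof.
move=> hz.
pose A i j := `|(z i.+1 - z i) j| <= (2^-1) ^+ i :> R[i].
pose m j := diag_index A j j.
have pw0 k : 0 <= 2 * (2^-1) ^+ k :> R[i] by rewrite mulr_ge0 // exprn_ge0.
have tele j k : (k <= m j)%N -> `|z (m j) j - z k j| <= 2 * (2^-1) ^+ k.
  move=> km; apply: le_trans (_ : 2 * (2^-1) ^+ k - 2 * (2^-1) ^+ (m j) <= _).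
    apply: (@telescope_half _ (fun i => z i j)) => // i /andP[_ im].
    exact: (diag_indexP A j j).2.
  by rewrite gerBl.
have yb : bounded_seq (fun j => z (m j) j).
  have [B hB] := bfunP (z 0); exists (2 + B) => j.
  rewrite -[X in `|X|](subrK (z 0 j)) (le_trans (ler_normD _ _)) // rmorphD.
  rewrite lerD //; apply: le_trans (tele j 0 _) _ => //.
  by rewrite expr0 mulr1 rmorph_nat.
exists (BSeq yb) => k; apply: unorm_le => //.
have wA : fu_sets w [set j | forall i, (i < k)%N -> A i j].
  elim: k => [|k ih]; first by apply: filterE => j.
  apply: filterS (filterI ih (unorm_lt (hz k))) => j [/= h1 h2] i.
  by rewrite ltnS leq_eqVlt => /predU1P[->//|]; exact: h1.
apply: filterS (filterI (tail_in_ultra k) wA) => j [/= h1 h2].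
by rewrite /= distrC; apply: tele; exact: diag_index_ge.
Qed.

Lemma ultra_space_complete : seq_complete (dot_space udot).
Proof.
move=> u uC.
have p0 i : 0 < (2^-1) ^+ i / 2 :> R[i] by rewrite divr_gt0 ?exprn_gt0 ?invr_gt0.
have [N hN] : {N : nat -> nat & forall i m n, (N i <= m)%N -> (N i <= n)%N ->
    `|u m - u n| <= (2^-1) ^+ i / 2}.
  by apply: (@choice _ _ (fun i N => forall m n, (N <= m)%N -> (N <= n)%N ->
    `|u m - u n| <= (2^-1) ^+ i / 2)) => i; exact: uC.
pose M i := (\sum_(k < i.+1) N k)%N.
have NM i : (N i <= M i)%N by rewrite /M big_ord_recr leq_addl.
have MS i : (M i <= M i.+1)%N by rewrite /M [leqRHS]big_ord_recr leq_addr.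
have [z hz] : {z : nat -> bseq H_ & forall i, ucl (z i) = u (M i)}.
  by apply: (@choice _ _ (fun i x => ucl x = u (M i))) => i; exact: ucl_surj.
have [|y hy] := @ultra_space_fast z.
  move=> i; rewrite -unorm_ucl uclB !hz.
  apply: le_lt_trans (hN i _ _ _ _) _ => //; first exact: leq_trans (MS i).
  by rewrite ltr_pdivrMr // ltr_pMr ?exprn_gt0 ?invr_gt0 // ltr1n.
exists (ucl y) => e e0.
have [k hk] : exists k, 3 * (2^-1) ^+ k <= e :> R[i].
  have e3 : 0 < e / 3 by rewrite divr_gt0.
  have [n hn] := small_invS e3; exists n.
  rewrite mulrC -ler_pdivlMr //; apply: le_trans hn.
  rewrite exprVn lef_pV2 ?posrE ?exprn_gt0 // -natrX ler_nat.
  exact: ltn_expl.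
exists (M k) => n hn; apply: le_trans hk.
have -> : u n - ucl y = (u n - u (M k)) + (u (M k) - ucl y) by rewrite subrKA.
rewrite (le_trans (ler_normD _ _)) //.
have -> : 3 * (2^-1) ^+ k = (2^-1) ^+ k + 2 * (2^-1) ^+ k :> R[i] by ring.
apply: lerD.
  apply: le_trans (hN k _ _ _ _) _ => //; first exact: leq_trans hn.
  by rewrite ler_pdivrMr // ler_peMr ?exprn_ge0 ?invr_ge0 // ler1n.
rewrite -hz -uclB; apply: le_trans (hy k).
by rewrite -[leRHS]unorm_ucl.
Qed.

Definition hilbert_ultraproduct : hilbert R := hilbert_of_dot ultra_space_complete.

End HilbertUltraproduct.

Section Operators.
Variables (R : realType) (H : hilbert R).
Implicit Types (x y z : H -> H) (M D : set (H -> H)) (xi eta : H).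

Definition op_norm_le x (B : R) := forall xi, `|x xi| <= B%:C%C * `|xi|.

Definition bounded_op : set (H -> H) :=
  [set x | linear x /\ exists B, op_norm_le x B].

Definition is_adjoint x y := forall xi eta, '[x xi, eta] = '[xi, y eta].

(* The strong operator topology is the topology of pointwise norm convergence. *)
Definition sot_closure M : set (H -> H) :=
  bounded_op `&` closure (M : set {ptws H -> H}).

Record von_neumann_algebra M : Prop := VonNeumannAlgebra {
  vna_bounded : M `<=` bounded_op ;
  vna_id : M id ;
  vna_linear : forall (a : R[i]) x y, M x -> M y ->
    M (fun xi => a *: x xi + y xi) ;
  vna_comp : forall x y, M x -> M y -> M (x \o y) ;
  vna_adjoint : forall x, M x -> exists2 y, M y & is_adjoint x y ;
  vna_closed : sot_closure M `<=` M }.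

Definition commutant M : set (H -> H) :=
  [set y | bounded_op y /\ forall x, M x -> x \o y =1 y \o x].

(* Haagerup's axioms for a standard form (M, H, J, P). *)
Record standard_form M (J : H -> H) (P : set H) : Prop := StandardForm {
  sf_vna : von_neumann_algebra M ;
  sf_antilinear : forall (a : R[i]) xi eta,
    J (a *: xi + eta) = a^* *: J xi + J eta ;
  sf_isometry : forall xi, `|J xi| = `|xi| ;
  sf_involutive : involutive J ;
  sf_selfdual : P = [set xi | forall eta, P eta -> 0 <= '[xi, eta]] ;
  sf_commutant : [set J \o x \o J | x in M] = commutant M ;
  sf_center : forall z, M z -> commutant M z -> is_adjoint z (J \o z \o J) ;
  sf_fixed : forall xi, P xi -> J xi = xi ;
  sf_cone : forall x xi, M x -> P xi -> P (x (J (x (J xi)))) }.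

Definition in_standard_form M := exists J P, standard_form M J P.

(* In R[i], a <= b means that b - a is real and nonnegative. *)
Definition op_le x y := forall xi, '[x xi, xi] <= '[y xi, xi].

Definition pos_part M : set (H -> H) :=
  [set x | M x /\ forall xi, 0 <= '[x xi, xi]].

Definition directed D :=
  forall x y, D x -> D y -> exists z, [/\ D z, op_le x z & op_le y z].

Definition is_pos_sup M D x :=
  [/\ pos_part M x, forall y, D y -> op_le y x &
      forall z, pos_part M z -> (forall y, D y -> op_le y z) -> op_le x z].

(* A function on the positive cone of M is represented by a function defined on
   all maps H -> H whose values outside of that cone are irrelevant. *)
Definition normal M (phi : (H -> H) -> \bar R) :=
  forall D x, D `<=` pos_part M -> D !=set0 -> directed D -> is_pos_sup M D x ->
    phi x = ereal_sup (phi @` D).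

(* Positive cone of the predual: the normal positive functionals on M. *)
Record predual_pos M (rho : (H -> H) -> R[i]) : Prop := PredualPos {
  pp_linear : forall (a : R[i]) x y, M x -> M y ->
    rho (fun xi => a *: x xi + y xi) = a * rho x + rho y ;
  pp_pos : forall x, pos_part M x -> 0 <= rho x ;
  pp_normal : normal M (fun x => (complex.Re (rho x))%:E) }.

Definition functional_norm_le M (rho : (H -> H) -> R[i]) (B : R) :=
  forall x, M x -> op_norm_le x 1 -> `|rho x| <= B%:C%C.

Record weight M (phi : (H -> H) -> \bar R) : Prop := Weight {
  weight_ge0 : forall x, pos_part M x -> (0 <= phi x)%E ;
  weightD : forall x y, pos_part M x -> pos_part M y ->
    phi (fun xi => x xi + y xi) = (phi x + phi y)%E ;
  weightZ : forall (a : R) x, 0 <= a -> pos_part M x ->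
    phi (fun xi => a%:C%C *: x xi) = (a%:E * phi x)%E }.

Definition faithful M (phi : (H -> H) -> \bar R) :=
  forall x, pos_part M x -> phi x = 0%E -> forall xi, x xi = 0.

(* Density for the weak topology on M induced by its predual; the predual is
   spanned by its positive cone, so positive functionals suffice. *)
Definition sigma_weakly_dense M (A : set (H -> H)) :=
  forall x, M x ->
    forall (n : nat) (rho : 'I_n -> (H -> H) -> R[i]),
      (forall i, predual_pos M (rho i)) ->
      forall e : R, 0 < e ->
        exists2 y, A y & forall i, `|rho i x - rho i y| < e%:C%C.

(* n_phi = {x in M | phi (x^* x) < +oo} *)
Definition square_finite M (phi : (H -> H) -> \bar R) : set (H -> H) :=
  [set x | M x /\
    exists y, [/\ M y, is_adjoint x y & (phi (y \o x) < +oo)%E]].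

Definition semifinite M (phi : (H -> H) -> \bar R) :=
  sigma_weakly_dense M (square_finite M phi).

Record nsf_weight M (phi : (H -> H) -> \bar R) : Prop := NsfWeight {
  nsf_is_weight : weight M phi ;
  nsf_normal : normal M phi ;
  nsf_semifinite : semifinite M phi ;
  nsf_faithful : faithful M phi }.

End Operators.

Section GrohRaynaud.
Variables (R : realType) (w : free_ultrafilter) (H_ : nat -> hilbert R).
Variable M_ : forall j, set (H_ j -> H_ j).
Arguments M_ : clear implicits.
Local Notation K := (hilbert_ultraproduct w H_).

(* (xi_j)_w for a bounded sequence, with the dummy value 0 otherwise *)
Definition ultra_vec (xi : forall j, H_ j) : K :=
  if pselect (bounded_seq xi) is left b then ucl w (BSeq b) else 0.

Definition ultra_op (x : forall j, H_ j -> H_ j) (k : K) : K :=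
  ultra_vec (fun j => x j (repr (k : ultra_space w H_) j)).

Definition bounded_op_seq (x : forall j, H_ j -> H_ j) :=
  (forall j, M_ j (x j)) /\ exists B, forall j, op_norm_le (x j) B.

Definition groh_raynaud : set (K -> K) :=
  sot_closure [set ultra_op x | x in bounded_op_seq].

Lemma ultra_vecE (x : bseq H_) : ultra_vec x = ucl w x.
Proof.
rewrite /ultra_vec; case: pselect => [b|/(_ (bfunP x))//].
by congr (ucl w _); apply: bseqP.
Qed.

Lemma ultra_vec_surj (k : K) : exists2 xi, bounded_seq xi & ultra_vec xi = k.
Proof.
have [x <-] := @ucl_surj R w H_ k; exists x; first exact: bfunP.
exact: ultra_vecE.
Qed.

Lemma ultra_vec_dot (xi eta : forall j, H_ j) :
  bounded_seq xi -> bounded_seq eta ->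
  '[ultra_vec xi, ultra_vec eta] = ulim w (fun j => '[xi j, eta j]).
Proof.
move=> b b'; rewrite (ultra_vecE (BSeq b)) (ultra_vecE (BSeq b')).
exact: udot_ucl.
Qed.

Lemma ultra_opE (x : forall j, H_ j -> H_ j) (B : R) (xi : forall j, H_ j) :
  (forall j, linear (x j)) -> (forall j, op_norm_le (x j) B) -> bounded_seq xi ->
  ultra_op x (ultra_vec xi) = ultra_vec (fun j => x j (xi j)).
Proof.
move=> xl xB bxi.
have bx (y : bseq H_) : bounded_seq (fun j => x j (y j)).
  have [B' hB'] := bfunP y; exists (`|B| * B') => j.
  apply: le_trans (xB j _) _; rewrite rmorphM /=.
  apply: le_trans (_ : `|B|%:C%C * `|y j| <= _).
    by rewrite ler_wpM2r // lecR ler_norm.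
  by rewrite ler_wpM2l // lecR.
rewrite (ultra_vecE (BSeq bxi)) /ultra_op.
rewrite (ultra_vecE (BSeq (bx _))) (ultra_vecE (BSeq (bx (BSeq bxi)))).
apply/uclP => /=.
apply: (@ulim_squeeze _ w _ (fun j => `|repr (ucl w (BSeq bxi)) j - xi j|) B).
- exact: (bounded_norm (repr (ucl w (BSeq bxi)) - BSeq bxi)).
- exact: (repr_ucl w (BSeq bxi)).
- move=> j; rewrite normr_id.
  have h u v : x j (u - v) = x j u - x j v.
    by have := xl j (-1) v u; rewrite !scaleN1r ![- _ + _]addrC.
  by have := xB j (repr (ucl w (BSeq bxi)) j - xi j); rewrite h.
Qed.

(* rho = (rho_j)_w in the predual of groh_raynaud: by density of the operators
   (x_j)_w and normality, the values on these operators determine rho. *)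
Definition is_ultra_functional (rho_ : forall j, (H_ j -> H_ j) -> R[i])
    (rho : (K -> K) -> R[i]) :=
  predual_pos groh_raynaud rho /\
  forall x, bounded_op_seq x ->
    rho (ultra_op x) = ulim w (fun j => rho_ j (x j)).

Definition ultra_minorant (phi_ : forall j, (H_ j -> H_ j) -> \bar R) :
    set ((K -> K) -> R[i]) :=
  [set rho | exists rho_ : forall j, (H_ j -> H_ j) -> R[i],
    [/\ forall j, predual_pos (M_ j) (rho_ j),
        forall j x, pos_part (M_ j) x ->
          ((complex.Re (rho_ j x))%:E <= phi_ j x)%E,
        exists B, forall j, functional_norm_le (M_ j) (rho_ j) B &
        is_ultra_functional rho_ rho]].

Definition majorizes (psi : (K -> K) -> \bar R) (F : set ((K -> K) -> R[i])) :=
  forall rho, F rho ->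
    forall x, pos_part groh_raynaud x -> ((complex.Re (rho x))%:E <= psi x)%E.

(* phi = (phi_j)_w: the supremum of the minorants is their least upper bound
   among the weights, ordered pointwise on the positive cone. *)
Record is_ultraproduct_weight (phi_ : forall j, (H_ j -> H_ j) -> \bar R)
    (phi : (K -> K) -> \bar R) : Prop := IsUltraproductWeight {
  upw_weight : weight groh_raynaud phi ;
  upw_majorizes : majorizes phi (ultra_minorant phi_) ;
  upw_least : forall psi, weight groh_raynaud psi ->
    majorizes psi (ultra_minorant phi_) ->
    forall x, pos_part groh_raynaud x -> (phi x <= psi x)%E }.

(* Whenever the pointwise supremum is a weight, it is the ultraproduct weight. *)
Lemma ultraproduct_weight_pointwise phi_ phi
    (S := fun x : K -> K =>
      ereal_sup [set (complex.Re (rho x))%:E | rho in ultra_minorant phi_]) :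
  weight groh_raynaud S ->
  is_ultraproduct_weight phi_ phi <->
  weight groh_raynaud phi /\ forall x, pos_part groh_raynaud x -> phi x = S x.
Proof.
move=> Sw.
have Smaj : majorizes S (ultra_minorant phi_).
  by move=> rho Frho x _; apply: ereal_sup_ubound; exists rho.
have Sle psi : majorizes psi (ultra_minorant phi_) ->
    forall x, pos_part groh_raynaud x -> (S x <= psi x)%E.
  move=> hpsi x x0; apply: ge_ereal_sup => _ [rho Frho <-].
  exact: hpsi.
split=> [[phiw phimaj least]|[phiw phiS]].
  split=> // x x0; apply/eqP; rewrite eq_le Sle // andbT.
  exact: least.
split=> // [rho Frho x x0|psi _ hpsi x x0]; rewrite phiS //.
  exact: Smaj.
exact: Sle.
Qed.

End GrohRaynaud.

Arguments groh_raynaud {R} w {H_} M_.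
Arguments is_ultraproduct_weight {R} w {H_} M_ phi_ phi.

(* Main.v *)
Require Import Defs.
From mathcomp Require Import all_boot all_order all_algebra spectral.
From mathcomp Require Import ring lra.
From mathcomp Require Import complex.
From mathcomp Require Import all_classical all_reals all_analysis.
Import Order.TTheory GRing.Theory Num.Theory Num.Def.
Import numFieldNormedType.Exports.
Set Implicit Arguments.
Unset Strict Implicit.
Unset Printing Implicit Defensive.
Local Open Scope classical_set_scope.
Local Open Scope ring_scope.

(** The factor of index j is the algebra of diagonal operators on C^(j+1), with
    coordinatewise conjugation and the cone of vectors with nonnegative
    coordinates as standard form. A choice of one coordinate i j in each factor
    gives a minimal projection (an atom) of the ultraproduct, the class of the
    projections onto the chosen lines; it is the rank one projection onto the
    class of the unit basis vectors [atomE].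

    For an ultraproduct weight phi = (phi_j)_w, the value at such an atom is the
    limit along w of the numbers phi_j (line number i j). The lower bound
    [weight_atom_ge] exhibits a minorant, and the upper bound [weight_atom_le]
    majorizes all minorants by a weight that is infinite off the line of the
    atom. Each factor has finitely many lines, so let i j be the heaviest line
    of phi_j. Were phi semifinite, its value at the resulting atom would be
    finite, because a semifinite weight is finite on minimal projections
    [nsf_rank_one_finite]; so the weights phi_j (line number i j) would be bounded
    by some constant C for w-almost every j. By the choice of i j, every atom
    would then have phi-value at most C. Hence the values of a semifinite
    ultraproduct weight on the atoms are bounded.

    It remains to construct a normal, semifinite, faithful weight that is
    unbounded on the atoms. The ultraproduct M is an abelian von Neumann algebra
    ([groh_raynaud_vna], [groh_raynaud_commutative]): it is the strong closure of a
    commutative algebra stable under x |-> J x J, which is the adjoint. In any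
    abelian M, take by Zorn's lemma a maximal family S of vectors with pairwise
    orthogonal supports in M. The sum over xi in S of <x xi, xi> is normal,
    faithful by maximality of S, and semifinite because the support of each
    member has finite weight and these supports exhaust the identity
    [vector_sum_nsf]. The family S may be required to contain prescribed vectors;
    multiples, of norms 1, 2, 3 and so on, of the unit vectors of infinitely many
    atoms make the weight unbounded on atoms [vector_sum_unbounded].

    Suprema in M are handled by Vigier's theorem [monotone_limit], which
    identifies them with strong limits; it yields the normality of vector
    functionals and the support projections. *)

(** * Positive operators and the strong topology *)

Lemma quad_discr (R : realFieldType) (a b1 b2 d : R) :
  (forall s t, 0 <= a + 2 * (s * b1 - t * b2) + (s ^+ 2 + t ^+ 2) * d) ->
  b1 ^+ 2 + b2 ^+ 2 <= a * d.
Proof.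
move=> h.
have a0 : 0 <= a by have := h 0 0; lra.
have d0 : 0 <= d.
  rewrite leNgt; apply/negP => dn.
  pose q := (a + 1) / - d.
  have dd : q * d = - (a + 1) by rewrite /q; field; rewrite lt_eqF.
  have q0 : 0 < q by rewrite divr_gt0 ?oppr_gt0 //; lra.
  (* The linear terms cancel in the sum of the two values. *)
  have := h (1 + q) 0; have := h (- (1 + q)) 0.
  nra.
have [d0'|] := boolP (0 < d); last first.
  rewrite -leNgt => d0'; have de : d = 0 by lra.
  move: h; rewrite de mulr0 => h.
  rewrite leNgt; apply/negP => n0.
  have := h (- ((a + 1) / (b1 ^+ 2 + b2 ^+ 2) * b1)) ((a + 1) / (b1 ^+ 2 + b2 ^+ 2) * b2).
  have -> : - ((a + 1) / (b1 ^+ 2 + b2 ^+ 2) * b1) * b1 -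
    (a + 1) / (b1 ^+ 2 + b2 ^+ 2) * b2 * b2 = - (a + 1) by field; rewrite gt_eqF.
  lra.
(* The minimum of the polynomial. *)
have := h (- (b1 / d)) (b2 / d).
have -> : a + 2 * (- (b1 / d) * b1 - b2 / d * b2) + ((- (b1 / d)) ^+ 2 + (b2 / d) ^+ 2) * d
  = (a * d - (b1 ^+ 2 + b2 ^+ 2)) / d by field; rewrite gt_eqF.
by rewrite pmulr_lge0 ?invr_gt0 // subr_ge0.
Qed.

Section ComplexFacts.
Variable R : realType.
Implicit Types z : R[i].

Lemma ge0_ReK z : 0 <= z -> (complex.Re z)%:C%C = z.
Proof. by move=> z0; rewrite RRe_real // ger0_real. Qed.

Lemma rcD (a b : R) : (a + b)%:C%C = a%:C%C + b%:C%C.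
Proof. exact: rmorphD. Qed.

Lemma rcM (a b : R) : (a * b)%:C%C = a%:C%C * b%:C%C.
Proof. exact: rmorphM. Qed.

Lemma Re_ge0 z : 0 <= z -> 0 <= complex.Re z.
Proof. by move=> z0; rewrite -lecR ge0_ReK. Qed.

Lemma Re_le z z' : z <= z' -> complex.Re z <= complex.Re z'.
Proof. by case: z z' => a b [c d]; rewrite lecE /= => /andP[]. Qed.

Lemma ReD z z' : complex.Re (z + z') = complex.Re z + complex.Re z'.
Proof. exact: raddfD. Qed.

Lemma ReB z z' : complex.Re (z - z') = complex.Re z - complex.Re z'.
Proof. exact: raddfB. Qed.

Lemma ReZ (a : R) z : complex.Re (a%:C%C * z) = a * complex.Re z.
Proof. by case: z => b c /=; rewrite mul0r subr0. Qed.

(** Testing a sesquilinear expression on all scalars gives both its hermitian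
    symmetry (nonnegative numbers are real) and the Cauchy-Schwarz inequality.
    It serves below for the form of a positive operator and for the form that
    a positive functional defines on an operator algebra. *)
Lemma complex_discriminant (al be ga de : R[i]) :
  (forall a : R[i], 0 <= al + a * be + a^* * ga + a * a^* * de) ->
  ga = be^* /\ `|be| ^+ 2 <= al * de.
Proof.
have h s t : (s +i* t)%C^* = (s -i* t)%C :> R[i] by [].
case: al be ga de => [a1 a2] [b1 b2] [g1 g2] [d1 d2] hq.
have {}hq s t := hq (s +i* t)%C.
have Im s t : a2 + (s * b2 + t * b1) + (s * g2 - t * g1) + (s ^+2 + t ^+ 2) * d2 = 0.
  have := hq s t; rewrite h lecE /= => /andP[/eqP + _]; lra.
have Re s t : 0 <= a1 + (s * b1 - t * b2) + (s * g1 + t * g2) + (s ^+2 + t ^+ 2) * d1.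
  have := hq s t; rewrite h lecE /= => /andP[_]; lra.
have I0 := Im 0 0; have I1 := Im 1 0; have I2 := Im (-1) 0; have I3 := Im 0 1.
have gb : g1 = b1 by lra.
have gb2 : g2 = - b2 by lra.
rewrite gb gb2 h; split=> //.
have a20 : a2 = 0 by lra.
have d20 : d2 = 0 by lra.
have q : b1 ^+ 2 + b2 ^+ 2 <= a1 * d1.
  by apply: quad_discr => s t; have := Re s t; rewrite gb gb2; lra.
rewrite normCK h lecE /= a20 d20; apply/andP; split; first by apply/eqP; lra.
lra.
Qed.
End ComplexFacts.

Section Dot.
Variables (R : realType) (H : hilbert R).
Implicit Types x y z : H.
Lemma dotDl x y z : '[x + y, z] = '[x, z] + '[y, z]. Proof. exact: linearDl. Qed.
Lemma dotDr x y z : '[z, x + y] = '[z, x] + '[z, y]. Proof. exact: linearDr. Qed.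
Lemma dotBl x y z : '[x - y, z] = '[x, z] - '[y, z]. Proof. exact: linearBl. Qed.
Lemma dotBr x y z : '[z, x - y] = '[z, x] - '[z, y]. Proof. exact: linearBr. Qed.
Lemma dot0l z : '[0, z] = 0. Proof. exact: linear0l. Qed.
Lemma dot0r z : '[z, 0] = 0. Proof. exact: linear0r. Qed.
Lemma dotZl a y z : '[a *: y, z] = a * '[y, z]. Proof. exact: linearZl_LR. Qed.
Lemma dotZr a y z : '[z, a *: y] = a^* * '[z, y]. Proof. exact: (linearZr_LR (hdot H)). Qed.
Lemma dot_conj x y : '[x, y] = '[y, x]^*. Proof. exact: dotC. Qed.
End Dot.

Section Operators.
Variables (R : realType) (H : hilbert R).
Implicit Types (x y z : H -> H) (M D : set (H -> H)) (xi eta : H).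

Section LinearMaps.
Variable x : H -> H.
Hypothesis xl : linear x.
Lemma lin0 : x 0 = 0.
Proof. by have := xl (-1) 0 0; rewrite scaler0 addr0 scaleN1r addNr. Qed.
Lemma linD xi eta : x (xi + eta) = x xi + x eta.
Proof. by have := xl 1 xi eta; rewrite !scale1r. Qed.
Lemma linZ a xi : x (a *: xi) = a *: x xi.
Proof. by have := xl a xi 0; rewrite !addr0 lin0 addr0. Qed.
Lemma linB xi eta : x (xi - eta) = x xi - x eta.
Proof. by rewrite linD -scaleN1r linZ scaleN1r. Qed.
End LinearMaps.

Lemma lin_comp x y : linear x -> linear y -> linear (x \o y).
Proof. by move=> xl yl a u v /=; rewrite yl xl. Qed.

Lemma lin_comb a x y : linear x -> linear y -> linear (fun xi => a *: x xi + y xi).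
Proof.
move=> xl yl b u v; rewrite xl yl !scalerDr !scalerA [a * b]mulrC.
by rewrite -!addrA; congr (_ + _); rewrite addrCA.
Qed.

Definition positive x := forall xi, 0 <= '[x xi, xi].

Lemma positive_form x : linear x -> positive x -> forall xi eta,
  '[x xi, eta] = '[xi, x eta] /\
  `|'[x xi, eta]| ^+ 2 <= '[x eta, eta] * '[x xi, xi].
Proof.
move=> xl xp xi eta.
have [h1 h2] : '[x eta, xi] = '[x xi, eta]^* /\
    `|'[x xi, eta]| ^+ 2 <= '[x eta, eta] * '[x xi, xi].
  apply: complex_discriminant => a.
  have := xp (eta + a *: xi); rewrite (linD xl) (linZ xl).
  rewrite !dotDl !dotDr !dotZl !dotZr.
  by congr (_ <= _); ring.
by split=> //; rewrite [RHS]dot_conj h1 conjCK.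
Qed.

Lemma positive_sym x : linear x -> positive x -> is_adjoint x x.
Proof. by move=> xl xp xi eta; have [] := positive_form xl xp xi eta. Qed.

Lemma op_norm_form x B xi : op_norm_le x B -> `|'[x xi, xi]| <= B%:C%C * '[xi, xi].
Proof.
move=> xB; apply: le_trans (hilbert_cauchy_schwarz _ _) _.
by rewrite -hnormE expr2 mulrA ler_wpM2r.
Qed.

(** Cauchy-Schwarz for the form of x, at the vectors xi and x xi. *)
Lemma positive_norm x (B : R) : linear x -> positive x ->
  (forall xi, '[x xi, xi] <= B%:C%C * '[xi, xi]) ->
  forall xi, `|x xi| ^+ 2 <= B%:C%C * '[x xi, xi].
Proof.
move=> xl xp xB xi; rewrite hnormE.
have [->|n0] := eqVneq (x xi) 0; first by rewrite dot0l mulrC dot0l mul0r.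
have [_] := positive_form xl xp xi (x xi).
have n1 : 0 < '[x xi, x xi] by exact: neq0_dnorm_gt0.
rewrite (ger0_norm (ltW n1)) => h.
rewrite -(ler_pM2r n1) -expr2; apply: le_trans h _.
by rewrite mulrAC ler_wpM2r.
Qed.

Lemma positive_op_norm x (B : R) : 0 <= B -> linear x -> positive x ->
  (forall xi, '[x xi, xi] <= B%:C%C * '[xi, xi]) -> op_norm_le x B.
Proof.
move=> B0 xl xp xB xi.
rewrite -(ler_pXn2r (n := 2)) ?nnegrE ?mulr_ge0 ?lecR //.
apply: le_trans (positive_norm xl xp xB xi) _.
by rewrite exprMn expr2 -mulrA ler_wpM2l ?lecR // hnormE.
Qed.

Lemma bounded_opP x : bounded_op x -> linear x /\ exists2 B : R, 0 <= B & op_norm_le x B.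
Proof.
move=> [xl [B xB]]; split=> //; exists `|B| => // xi; apply: le_trans (xB xi) _.
by rewrite ler_wpM2r // lecR ler_norm.
Qed.

Lemma bounded_op_comb (a : R[i]) x y : bounded_op x -> bounded_op y ->
  bounded_op (fun xi => a *: x xi + y xi).
Proof.
move=> /bounded_opP[xl [B B0 xB]] /bounded_opP[yl [B' B'0 yB]].
split; first exact: lin_comb.
exists (complex.Re `|a| * B + B') => xi.
rewrite (le_trans (ler_normD _ _)) // rcD rcM ge0_ReK //.
by rewrite mulrDl lerD // normrZ -mulrA ler_wpM2l.
Qed.

Lemma bounded_op_comp x y : bounded_op x -> bounded_op y -> bounded_op (x \o y).
Proof.
move=> /bounded_opP[xl [B B0 xB]] /bounded_opP[yl [B' B'0 yB]].
split; first exact: lin_comp.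
exists (B * B') => xi; apply: le_trans (xB _) _.
by rewrite rcM -mulrA ler_wpM2l // lecR.
Qed.

(** Basic strong neighbourhoods: finitely many vectors and a tolerance. *)
Lemma ptws_closureP M x : closure (M : set {ptws H -> H}) x <->
  forall (s : seq H) (e : R[i]), 0 < e ->
    exists2 y, M y & forall xi, xi \in s -> `|x xi - y xi| < e.
Proof.
pose U (s : seq H) (e : R[i]) : set {ptws H -> H} :=
  [set y | forall xi, xi \in s -> `|x xi - y xi| < e].
split=> [cx s e e0|h].
  have nU : nbhs (x : {ptws H -> H}) (U s e).
    elim: s => [|xi s ih]; first by apply: filterE => y xi; rewrite in_nil.
    have c := @proj_continuous H (fun=> H) xi (x : {ptws H -> H}).
    have b : nbhs (x xi) (ball (x xi) e) by exact: nbhsx_ballx.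
    apply: filterS (filterI ih (c _ b)) => y [/= h1 h2] eta.
    rewrite in_cons => /predU1P[->|]; last exact: h1.
    by move: h2; rewrite -ball_normE.
  by have [y [My Uy]] := cx _ nU; exists y.
pose F : set_system {ptws H -> H} :=
  filter_from [set p : seq H * R[i] | 0 < p.2] (fun p => U p.1 p.2).
have FF : Filter F.
  apply: filter_from_filter; first by exists ([::], 1); rewrite /= ltr01.
  move=> [s e] [s' e'] /= e0 e0'.
  have ee : 0 < e + e' by rewrite addr_gt0.
  have h1 : e * e' / (e + e') <= e.
    by rewrite -mulrA ler_piMr ?ltW // ltr_pdivrMr // mul1r ltrDr.
  have h2 : e * e' / (e + e') <= e'.
    by rewrite mulrAC ler_piMl ?ltW // ltr_pdivrMr // mul1r ltrDl.
  exists (s ++ s', e * e' / (e + e')) => /=; first by rewrite divr_gt0 ?mulr_gt0.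
  move=> y yU; split=> xi xis /=.
    by apply: lt_le_trans h1; apply: yU; rewrite mem_cat xis.
  by apply: lt_le_trans h2; apply: yU; rewrite mem_cat xis orbT.
have Fx : {ptws, F --> x}.
  apply/pointwise_cvgP => xi; apply/cvgrPdist_lt => e e0.
  by exists ([:: xi], e) => //= y /(_ xi); apply; rewrite mem_head.
move=> B /Fx [[s e] /= e0 sB].
by have [y My yU] := h s e e0; exists y; split=> //; exact: sB.
Qed.

End Operators.

(** * Strong limits of bounded monotone nets *)

Section Approximation.
Variable R : realType.

Lemma normc_Im (z : R[i]) : `|complex.Im z|%:C%C <= `|z|.
Proof.
have := normc_ge_Re ('i%C * z).
rewrite normrM [`|'i%C|]normc_def /= expr0n expr1n add0r sqrtr1 mul1r.
by case: z => a b /=; rewrite !mul0r mul1r sub0r normrN.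
Qed.

Lemma approx_ge0 (z : R[i]) :
  (forall e, 0 < e -> exists2 z', 0 <= z' & `|z - z'| <= e) -> 0 <= z.
Proof.
move=> h.
have {}h (e : R) : 0 < e -> `|complex.Im z| <= e /\ - e <= complex.Re z.
  move=> e0; have [|z' z'0 hz] := h e%:C%C; first by rewrite ltcR.
  have := le_trans (normc_Im _) hz; have := le_trans (normc_ge_Re _) hz.
  move: z'0; case: z z' {hz h} => a b [c d]; rewrite !lecR lecE /=.
  move=> /andP[/eqP -> c0]; rewrite oppr0 addr0 => h1 h2; split=> //.
  by move: h1; rewrite ler_norml => /andP[]; lra.
have i0 : complex.Im z = 0.
  apply/eqP; rewrite -normr_le0; apply/ler_addgt0Pl => e e0.
  by rewrite addr0; have [] := h e e0.
have r0 : 0 <= complex.Re z.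
  by apply/ler_addgt0Pl => e e0; have [_] := h e e0; lra.
by case: z i0 r0 {h} => a b /= -> r0; rewrite lecE /= eqxx.
Qed.

Lemma approx_eq0 (z : R[i]) : (forall e, 0 < e -> `|z| <= e) -> z = 0.
Proof.
move=> h; apply/eqP; rewrite -normr_le0 -oppr_ge0; apply: approx_ge0 => e e0.
by exists 0; rewrite // subr0 normrN normr_id h.
Qed.

Lemma approx_vec_eq (V : normedModType R[i]) (u v : V) :
  (forall e : R[i], 0 < e -> `|u - v| <= e) -> u = v.
Proof.
move=> h; apply/eqP; rewrite -subr_eq0 -normr_eq0; apply/eqP.
by apply: approx_eq0 => e e0; rewrite normr_id h.
Qed.

End Approximation.

Section MonotoneLimits.
Variables (R : realType) (H : hilbert R).
Implicit Types (x y z : H -> H) (M D : set (H -> H)) (xi eta : H).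

(** A nonnegativity condition on <u, xi> survives norm limits in u; this is how
    operator inequalities pass to strong limits. *)
Lemma form_closed (v xi : H) (c k : R[i]) :
  (forall e : R[i], 0 < e -> exists2 u, `|v - u| < e & 0 <= c + k * '[u, xi]) ->
  0 <= c + k * '[v, xi].
Proof.
move=> h; apply: approx_ge0 => e e0.
have p0 : 0 < `|k| * `|xi| + 1 by rewrite ltr_wpDl // mulr_ge0.
have [u uv u0] := h (e / (`|k| * `|xi| + 1)) (divr_gt0 e0 p0).
exists (c + k * '[u, xi]) => //.
rewrite opprD addrACA subrr add0r -mulrBr -dotBl normrM.
apply: le_trans (_ : `|k| * (`|v - u| * `|xi|) <= _).
  by rewrite ler_wpM2l // hilbert_cauchy_schwarz.
rewrite mulrCA; apply: le_trans (_ : `|v - u| * (`|k| * `|xi| + 1) <= _).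
  by rewrite ler_wpM2l // lerDl.
by rewrite -ler_pdivlMr // ltW.
Qed.

Lemma op_le_trans y x z : op_le x y -> op_le y z -> op_le x z.
Proof. by move=> xy yz xi; exact: le_trans (xy xi) (yz xi). Qed.

Variables (M D : set (H -> H)) (B : R).
Hypotheses (Mv : von_neumann_algebra M) (B0 : 0 <= B).
Hypotheses (DM : D `<=` pos_part M) (Dn : D !=set0) (Dd : directed D).
Hypothesis DB : forall d, D d -> forall xi, '[d xi, xi] <= B%:C%C * '[xi, xi].

Let Dlin d : D d -> linear d.
Proof. by move=> /DM[/(vna_bounded Mv)[]]. Qed.

Let Dpos d : D d -> positive d.
Proof. by move=> /DM[]. Qed.

(** Above a member d0 whose value <d0 xi, xi> nearly attains the supremum, the
    vectors d xi move little, because d - d0 is positive and bounded by B and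
    |(d - d0) xi|^2 <= B <(d - d0) xi, xi>. *)
Lemma monotone_cauchy xi (e : R[i]) : 0 < e ->
  exists2 d0, D d0 & forall d, D d -> op_le d0 d -> `|d0 xi - d xi| < e.
Proof.
move=> e0.
pose E := [set complex.Re '[d xi, xi] | d in D].
have sE : has_sup E.
  split; first by have [d Dd0] := Dn; exists (complex.Re '[d xi, xi]), d.
  exists (B * complex.Re '[xi, xi]) => _ [d Dd0 <-].
  by rewrite -ReZ; apply: Re_le; exact: DB.
have er : 0 < complex.Re e by rewrite -ltcR ge0_ReK // ltW.
have B1 : 0 < B + 1 by rewrite ltr_wpDl.
pose del := complex.Re e ^+ 2 / (B + 1).
have del0 : 0 < del by rewrite divr_gt0 // exprn_gt0.
have [_ [d0 Dd0 <-] hd0] := sup_adherent del0 sE.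
exists d0 => // d Dd1 le_d.
pose y eta := (-1) *: d0 eta + d eta.
have yE eta : '[y eta, eta] = '[d eta, eta] - '[d0 eta, eta].
  by rewrite dotDl dotZl mulN1r addrC.
have yl : linear y by apply: lin_comb; exact: Dlin.
have yp : positive y by move=> eta; rewrite yE subr_ge0; exact: le_d.
have yB eta : '[y eta, eta] <= B%:C%C * '[eta, eta].
  rewrite yE; apply: le_trans (DB Dd1 eta); rewrite gerBl; exact: Dpos.
have := positive_norm yl yp yB xi.
have -> : `|y xi| = `|d0 xi - d xi| by rewrite /y scaleN1r addrC distrC.
move=> hn.
rewrite -(ltr_pXn2r (n := 2)) ?nnegrE ?normr_ge0 ?(ltW e0) //.
apply: le_lt_trans hn _; rewrite -(ge0_ReK (yp xi)) -(ge0_ReK (ltW e0)).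
rewrite -rcM -rmorphXn /= ltcR.
have hy : complex.Re '[y xi, xi] < del.
  rewrite yE ReB; have := ub_le_sup sE.2 (ex_intro2 _ _ d Dd1 erefl).
  by move: hd0; set a := complex.Re _; set b := complex.Re _; lra.
apply: le_lt_trans (_ : B * del < _); first by rewrite ler_wpM2l // ltW.
by rewrite /del mulrCA gtr_pMr ?exprn_gt0 // ltr_pdivrMr // mul1r ltrDl.
Qed.

Let G : set_system (H -> H) :=
  filter_from D (fun d => D `&` [set d' | op_le d d']).

Let G_proper : ProperFilter G.
Proof.
apply: filter_from_proper; last by move=> d Dd0; exists d; split.
apply: filter_from_filter => // d d' Dd0 Dd'.
have [d2 [Dd2 h1 h2]] := Dd Dd0 Dd'; exists d2 => //.
by move=> y [Dy hy]; split; split=> //=; apply: op_le_trans hy.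
Qed.

Let G_D : G D.
Proof. by have [d Dd0] := Dn; exists d => // y []. Qed.

Let G_ge d : D d -> G [set d' | op_le d d'].
Proof. by move=> Dd0; exists d => // y []. Qed.

Let slim xi : H := lim ((fun d => d xi) @ G).

Let slim_cvg xi : (fun d : H -> H => d xi) @ G --> slim xi.
Proof.
have FG := fmap_proper_filter (fun d : H -> H => d xi) G_proper.
suff c : cauchy ((fun d : H -> H => d xi) @ G).
  exact: (@cauchy_cvg H _ FG c).
apply: cauchy_exP => e e0.
have [d0 Dd0 h] := monotone_cauchy xi e0.
exists (d0 xi); exists d0 => // d [Dd1 /= le_d].
by rewrite -ball_normE /=; exact: h.
Qed.

Let slim_near xi (e : R[i]) : 0 < e -> G [set d | `|slim xi - d xi| < e].
Proof.
have FG : Filter G by exact: filter_filter.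
by move=> e0; move/cvgrPdist_lt: (@slim_cvg xi) => /(_ e e0).
Qed.

(** Vigier's theorem: a bounded increasing net of positive elements converges
    strongly to its least upper bound. The limit is taken pointwise along the
    filter of tails and lies in M because M is strongly closed. *)
Lemma monotone_limit : exists s, [/\ pos_part M s,
  forall d, D d -> op_le d s,
  forall z, (forall d, D d -> op_le d z) -> op_le s z &
  forall xi (e : R[i]), 0 < e -> exists2 d, D d & `|s xi - d xi| < e].
Proof.
have FG := G_proper.
have slin : linear slim.
  move=> a xi eta; have := @slim_cvg (a *: xi + eta).
  have h : (fun d : H -> H => a *: d xi + d eta) @ G --> a *: slim xi + slim eta.
    by apply: cvgD; [apply: cvgZl_tmp; exact: slim_cvg|exact: slim_cvg].
  move=> h'; apply: (cvg_unique _ h') => //.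
  apply: cvg_trans h; apply: near_eq_cvg; apply: filterS G_D => d Dd0.
  by rewrite (Dlin Dd0).
have G_form xi c k : G [set d | 0 <= c + k * '[d xi, xi]] -> 0 <= c + k * '[slim xi, xi].
  move=> Gc; apply: form_closed => e e0.
  by have [d [h1 h2]] := filter_ex (filterI (slim_near xi e0) Gc); exists (d xi).
have sge d : D d -> op_le d slim.
  move=> Dd0 xi; rewrite -subr_ge0 addrC -[X in _ + X]mul1r.
  apply: G_form; apply: filterS (G_ge Dd0) => d' /= le_d.
  by rewrite mul1r addrC subr_ge0.
have sle z : (forall d, D d -> op_le d z) -> op_le slim z.
  move=> hz xi; rewrite -subr_ge0 -mulN1r.
  by apply: (G_form xi '[z xi, xi] (-1)); apply: filterS G_D => d Dd0;
     rewrite /= mulN1r subr_ge0 hz.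
have spos : positive slim.
  have [d Dd0] := Dn; move=> xi; apply: le_trans (sge d Dd0 xi); exact: Dpos.
have sB : op_norm_le slim B.
  apply: positive_op_norm => // xi; rewrite -subr_ge0 -mulN1r.
  by apply: (G_form xi (B%:C%C * '[xi, xi]) (-1)); apply: filterS G_D => d Dd0;
    rewrite /= mulN1r subr_ge0 DB.
exists slim; split=> // [|xi e e0]; last first.
  by have [d [h1 h2]] := filter_ex (filterI (slim_near xi e0) G_D); exists d.
split=> //; apply: (vna_closed Mv); split; first by split=> //; exists B.
apply/ptws_closureP => s e e0.
have Gs : G [set d | forall xi, xi \in s -> `|slim xi - d xi| < e].
  elim: s => [|xi s ih]; first by apply: filterE => d xi; rewrite in_nil.
  apply: filterS (filterI ih (slim_near xi e0)) => d [/= h1 h2] eta.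
  by rewrite in_cons => /predU1P[->//|]; exact: h1.
have [d [h1 h2]] := filter_ex (filterI Gs G_D).
by exists d => //; have [] := DM h2.
Qed.

End MonotoneLimits.

(** * Sums of vector functionals *)

Lemma ge0_esumZl (R : realType) (T : choiceType) (S : set T) (f : T -> \bar R) (a : R) :
  0 <= a -> (forall i, S i -> (0 <= f i)%E) ->
  (\esum_(i in S) (a%:E * f i) = a%:E * \esum_(i in S) f i)%E.
Proof.
have le (b : R) (g : T -> \bar R) : 0 < b -> (forall i, S i -> (0 <= g i)%E) ->
    (\esum_(i in S) (b%:E * g i) <= b%:E * \esum_(i in S) g i)%E.
  move=> b0 g0; apply: ge_ereal_sup => _ [A [Af AS] <-].
  rewrite fsbig_finite //= big_seq -ge0_sume_distrr; last first.
    move=> i; rewrite in_fset_set // inE => /AS; exact: g0.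
  rewrite lee_pmul2l // ?lte_fin //; apply: esum_ge; exists A => //.
  by rewrite fsbig_finite //= [leRHS]big_seq.
rewrite le_eqVlt => /predU1P[<- _|a0 f0].
  by rewrite mul0e esum1 // => i _; rewrite mul0e.
apply/eqP; rewrite eq_le le //=.
have ai0 : 0 < a^-1 by rewrite invr_gt0.
rewrite -(@lee_pmul2l _ a^-1%:E) ?lte_fin // muleA -EFinM mulVf ?gt_eqF // mul1e.
apply: le_trans (le _ (fun i => a%:E * f i)%E ai0 _); last first.
  by move=> i Si; apply: mule_ge0; [rewrite lee_fin ltW|exact: f0].
by apply: le_esum => i _; rewrite muleA -EFinM mulVf ?gt_eqF // mul1e.
Qed.

Section Normality.
Variables (R : realType) (H : hilbert R).
Implicit Types (x y z : H -> H) (M D : set (H -> H)) (xi eta : H).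
Variable M : set (H -> H).
Hypothesis Mv : von_neumann_algebra M.

Lemma vna_lin x : M x -> linear x.
Proof. by move=> /(vna_bounded Mv)[]. Qed.

Lemma pos_part_linear x : pos_part M x -> linear x.
Proof. by move=> [/vna_lin]. Qed.

(** Cauchy-Schwarz for the form of x, at the vectors xi and x xi. *)
Lemma positive_form0 x xi : linear x -> positive x -> '[x xi, xi] = 0 -> x xi = 0.
Proof.
move=> xl xp x0; have [_] := positive_form xl xp xi (x xi).
rewrite x0 mulr0 => h; apply/eqP; apply: contraT => n0.
have := @neq0_dnorm_gt0 _ _ _ (hdot H) _ n0; rewrite lt_def => /andP[/negP d0 _]; case: d0.
by rewrite -normr_eq0 -sqrf_eq0 eq_le h exprn_ge0.
Qed.

Lemma Re_form_ge0 x xi : pos_part M x -> (0 <= (complex.Re '[x xi, xi])%:E)%E.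
Proof. by move=> [_ xp]; rewrite lee_fin; apply: Re_ge0. Qed.

(** An order-theoretic least upper bound in the positive cone agrees with the
    strong limit of the net, so finitely many vector states approach their
    values on it simultaneously. *)
Lemma lub_sum D x (s : seq H) (e : R) : D `<=` pos_part M -> D !=set0 ->
  directed D -> is_pos_sup M D x -> 0 < e ->
  exists2 d, D d &
    \sum_(xi <- s) complex.Re '[x xi, xi] <= \sum_(xi <- s) complex.Re '[d xi, xi] + e.
Proof.
move=> DM Dn Dd [xM xub xlub].
have /bounded_opP[xl [B B0 xB]] := vna_bounded Mv xM.1.
have DB d : D d -> forall xi, '[d xi, xi] <= B%:C%C * '[xi, xi].
  move=> Dd0 xi; apply: le_trans (xub d Dd0 xi) _.
  by apply: le_trans (op_norm_form xi xB); rewrite ger0_norm // xM.2.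
have [t [tM tub tlub tlim]] := monotone_limit Mv B0 DM Dn Dd DB.
have xt : op_le x t by exact: xlub.
elim: s e => [|xi s ih] e e0.
  by have [d Dd0] := Dn; exists d => //; rewrite !big_nil add0r ltW.
have e20 : 0 < e / 2 by rewrite divr_gt0.
have [d1 Dd1 h1] := ih _ e20.
have [d2 Dd2 h2] : exists2 d, D d & complex.Re '[x xi, xi] <= complex.Re '[d xi, xi] + e / 2.
  have n0 : 0 < `|xi| + 1 by rewrite ltr_wpDl.
  have e2C : 0 < (e / 2)%:C%C by rewrite ltcR.
  have [d Dd0 hd] := tlim xi _ (divr_gt0 e2C n0).
  exists d => //; rewrite -lerBlDl -ReB; have := Re_le (xt xi).
  have : `|'[t xi - d xi, xi]| <= (e / 2)%:C%C.
    apply: le_trans (hilbert_cauchy_schwarz _ _) _.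
    apply: le_trans (_ : `|t xi - d xi| * (`|xi| + 1) <= _).
      by rewrite ler_wpM2l // lerDl.
    by rewrite -ler_pdivlMr // ltW.
  move=> /(le_trans (normc_ge_Re _)); rewrite lecR dotBl !ReB ler_norml => /andP[_].
  lra.
have [d [Dd0 hd1 hd2]] := Dd _ _ Dd1 Dd2; exists d => //.
rewrite !big_cons; have := Re_le (hd2 xi).
have : \sum_(xi <- s) complex.Re '[d1 xi, xi] <= \sum_(xi <- s) complex.Re '[d xi, xi].
  by apply: ler_sum => eta _; exact: Re_le.
lra.
Qed.

Definition vector_sum_weight (S : set H) x : \bar R :=
  \esum_(xi in S) (complex.Re '[x xi, xi])%:E.

Lemma op_le_vector_sum S x y : op_le x y ->
  (vector_sum_weight S x <= vector_sum_weight S y)%E.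
Proof. by move=> xy; apply: le_esum => xi _; rewrite lee_fin Re_le. Qed.

Lemma vector_sum_weightP S : weight M (vector_sum_weight S).
Proof.
split=> [x xM|x y xM yM|a x a0 xM].
- by apply: esum_ge0 => xi _; exact: Re_form_ge0.
- rewrite -esumD; [|by move=> xi _; exact: Re_form_ge0..].
  by apply: eq_esum => xi _; rewrite dotDl ReD EFinD.
- rewrite -ge0_esumZl //; last by move=> xi _; exact: Re_form_ge0.
  by apply: eq_esum => xi _; rewrite dotZl ReZ EFinM.
Qed.

(** Suprema over the net and over finite subfamilies are exchanged, using that
    the net is directed. *)
Lemma vector_sum_normal S : normal M (vector_sum_weight S).
Proof.
move=> D x DM Dn Dd xsup; have [xM xub _] := xsup.
apply/eqP; rewrite eq_le; apply/andP; split; last first.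
  by apply: ge_ereal_sup => _ [d Dd0 <-]; apply: op_le_vector_sum; exact: xub.
apply: ge_ereal_sup => _ [A [Af AS] <-].
rewrite fsbig_finite //= sumEFin; apply/lee_addgt0Pr => e e0.
have [d Dd0 hd] := lub_sum (finmap.enum_fset (fset_set A)) DM Dn Dd xsup e0.
apply: le_trans (_ : (\sum_(xi <- finmap.enum_fset (fset_set A))
  complex.Re '[d xi, xi])%:E + e%:E <= _)%E.
  by rewrite -EFinD lee_fin.
rewrite leeD2r //; apply: le_trans (ereal_sup_ubound _); last by exists d.
apply: esum_ge; exists A => //.
by rewrite fsbig_finite //= sumEFin.
Qed.

Lemma vector_functional_normal xi : normal M (fun x => (complex.Re '[x xi, xi])%:E).
Proof.
have e x : pos_part M x -> (complex.Re '[x xi, xi])%:E = vector_sum_weight [set xi] x.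
  by move=> xM; rewrite /vector_sum_weight esum_set1 // Re_form_ge0.
move=> D x DM Dn Dd xsup; have [xM _ _] := xsup.
rewrite e // (@vector_sum_normal [set xi] D x DM Dn Dd xsup); congr ereal_sup.
by apply/seteqP; split=> _ [d Dd0 <-]; exists d => //; rewrite e //; exact: DM.
Qed.

Lemma vector_functional xi : predual_pos M (fun x => '[x xi, xi]).
Proof.
split=> [a x y _ _|x [_]|]; [by rewrite dotDl dotZl|exact|].
exact: vector_functional_normal.
Qed.

Lemma vna_compl x : M x -> M (fun xi => xi - x xi).
Proof.
move=> Mx; have := vna_linear Mv (-1) Mx (vna_id Mv).
by congr M; apply/funext => xi; rewrite scaleN1r addrC.
Qed.

Lemma vnaZ a x : M x -> M (fun xi => a *: x xi).
Proof.
move=> Mx; have := vna_linear Mv (a - 1) Mx Mx.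
by congr M; apply/funext => xi; rewrite scalerBl scale1r subrK.
Qed.

(** Cauchy-Schwarz for the form that sends x, y to rho of x times the adjoint of
    y: it is nonnegative at x + b r for every scalar b. *)
Lemma predual_cauchy_schwarz rho x x' r : predual_pos M rho ->
  M x -> M x' -> is_adjoint x x' -> M r -> is_adjoint r r -> (forall xi, r (r xi) = r xi) ->
  `|rho (x \o r)| ^+ 2 <= rho (x \o x') * rho r.
Proof.
move=> [rl rp _] Mx Mx' xx' Mr rr r2.
refine (proj2 (@complex_discriminant R _ _ (rho (r \o x')) _ _)) => a.
pose T xi := a *: x (r xi) + (a^* *: r (x' xi) + ((a * a^*) *: r xi + x (x' xi))).
have MT1 : M (fun xi => (a * a^*) *: r xi + x (x' xi)).
  by apply: vna_linear => //; exact: (vna_comp Mv Mx Mx').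
have MT2 : M (fun xi => a^* *: r (x' xi) + ((a * a^*) *: r xi + x (x' xi))).
  by apply: (vna_linear Mv _ (vna_comp Mv Mr Mx')).
have MT : M T by apply: (vna_linear Mv _ (vna_comp Mv Mx Mr)).
have -> : rho (x \o x') + a * rho (x \o r) + a^* * rho (r \o x') + a * a^* * rho r = rho T.
  rewrite /T (rl _ _ _ (vna_comp Mv Mx Mr) MT2) (rl _ _ _ (vna_comp Mv Mr Mx') MT1).
  by rewrite (rl _ _ _ Mr (vna_comp Mv Mx Mx')); ring.
apply: rp; split=> // xi.
have -> : '[T xi, xi] = '[x' xi + a *: r xi, x' xi + a *: r xi]; last exact: dnorm_ge0.
have rxi : '[r xi, xi] = '[r xi, r xi] by rewrite -rr r2.
rewrite /T !(dotDl, dotDr, dotZl, dotZr) !xx' (rr (x' xi)) rxi.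
by ring.
Qed.

End Normality.

(** * Faithful semifinite weights on abelian von Neumann algebras *)

Section AbelianWeights.
Variables (R : realType) (H : hilbert R).
Implicit Types (x y z p q : H -> H) (xi eta zeta : H).
Variable M : set (H -> H).
Hypothesis Mv : von_neumann_algebra M.
Hypothesis Mc : forall x y, M x -> M y -> forall xi, x (y xi) = y (x xi).

Lemma adjoint_sym x y : is_adjoint x y -> is_adjoint y x.
Proof. by move=> xy xi eta; rewrite dot_conj -xy -dot_conj. Qed.

Record projection p : Prop := Projection {
  proj_in : M p ;
  proj_sym : is_adjoint p p ;
  proj_idem : forall xi, p (p xi) = p xi }.

Lemma projection_form p xi : projection p -> '[p xi, xi] = '[p xi, p xi].
Proof. by move=> [_ ps pi]; rewrite -ps pi. Qed.

Lemma projection_pos p : projection p -> pos_part M p.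
Proof.
by move=> pp; split=> [|xi]; [exact: proj_in|rewrite projection_form // dnorm_ge0].
Qed.

Lemma projection_compl p : projection p -> projection (fun xi => xi - p xi).
Proof.
move=> [pM ps pi]; split=> [|xi eta|xi]; first exact: vna_compl.
  by rewrite dotBl dotBr ps.
by rewrite (linB (vna_lin Mv pM)) pi subrr subr0.
Qed.

Lemma projection_le1 p : projection p -> op_le p id.
Proof.
move=> pp xi; rewrite -subr_ge0 -dotBl.
exact: (projection_pos (projection_compl pp)).2.
Qed.

(** The support projection of xi is the infimum of c^* c over the contractions c
    of M with c xi = xi. This set is directed downwards, since (c d)^* (c d) lies
    below both c^* c and d^* d by commutativity, so the infimum p exists as a
    strong limit. It fixes xi, and being itself such a contraction it satisfies
    p <= p^2, hence is a projection. If x >= 0 kills xi, then c = 1 - x / (B + 1)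
    competes in the infimum for B a bound of x, which forces x p = 0. *)
Lemma support_projection xi : exists p, [/\ projection p, p xi = xi &
  forall x, pos_part M x -> x xi = 0 -> forall eta, x (p eta) = 0].
Proof.
pose contr c := [/\ M c, op_norm_le c 1 & c xi = xi].
have contr1 : contr id by split; [exact: vna_id|move=> eta; rewrite mul1r|].
have contr_form c eta : contr c -> '[c eta, c eta] <= '[eta, eta].
  move=> [_ c1 _]; rewrite -!hnormE ler_pXn2r ?nnegrE //.
  by have := c1 eta; rewrite mul1r.
pose D := [set h | exists2 c, contr c & M h /\
  forall eta, '[h eta, eta] = '[eta, eta] - '[c eta, c eta]].
have DM : D `<=` pos_part M.
  by move=> h [c cc [Mh hE]]; split=> // eta; rewrite hE subr_ge0 contr_form.
have DE c c' : contr c -> M c' -> is_adjoint c c' -> D (fun eta => eta - c' (c eta)).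
  move=> cc Mc' ccc'; exists c => //; split.
    exact: (vna_compl Mv (vna_comp Mv Mc' (let: And3 a _ _ := cc in a))).
  by move=> eta; rewrite dotBl (adjoint_sym ccc').
have Dn : D !=set0.
  by exists (fun eta => eta - eta); apply: (DE id id) => //; exact: vna_id.
have Dd : directed D.
  move=> h k [c cc [_ hE]] [d dd [_ kE]].
  have [Mcc c1 cxi] := cc; have [Md d1 dxi] := dd.
  have cd : contr (c \o d).
    split; [exact: vna_comp| |by rewrite /= dxi].
    by move=> eta; apply: le_trans (c1 _) _; rewrite mul1r.
  have [e Me ecd] := vna_adjoint Mv (vna_comp Mv Mcc Md).
  have lE eta : '[eta - e (c (d eta)), eta] = '[eta, eta] - '[c (d eta), c (d eta)].
    by rewrite dotBl (adjoint_sym ecd).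
  exists (fun eta => eta - e (c (d eta))); split; first exact: (DE (c \o d) e).
    by move=> eta; rewrite lE hE lerD2l lerN2 (Mc Mcc Md) contr_form.
  by move=> eta; rewrite lE kE lerD2l lerN2 contr_form.
have DB h : D h -> forall eta, '[h eta, eta] <= 1%:C%C * '[eta, eta].
  by move=> [c cc [_ hE]] eta; rewrite mul1r hE gerBl dnorm_ge0.
have [s [[Ms sp] sub slub slim]] := monotone_limit Mv ler01 DM Dn Dd DB.
pose p eta := eta - s eta.
have Mp : M p by exact: vna_compl.
have pl : linear p := vna_lin Mv Mp.
have pE eta : '[p eta, eta] = '[eta, eta] - '[s eta, eta] by rewrite dotBl.
have pp : positive p.
  move=> eta; rewrite pE subr_ge0; apply: slub => d Dd0 zeta.
  by have := DB _ Dd0 zeta; rewrite mul1r.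
have p1 eta : '[p eta, eta] <= 1%:C%C * '[eta, eta].
  by rewrite mul1r pE gerBl.
have sxi : s xi = 0.
  apply: positive_form0 => //; first exact: vna_lin Ms.
  apply/eqP; rewrite eq_le sp andbT -subr_ge0 sub0r -mulN1r -[X in 0 <= X]add0r.
  apply: form_closed => e e0; have [h [c cc [Mh hE]] hs] := slim xi e e0.
  exists (h xi) => //; have [_ _ cxi] := cc.
  by rewrite hE cxi subrr mulr0 addr0.
have pxi : p xi = xi by rewrite /p sxi subr0.
have pc : contr p by split=> //; exact: positive_op_norm.
have pmin c eta : contr c -> '[p eta, eta] <= '[c eta, c eta].
  move=> cc; have [Mcc _ _] := cc; have [c' Mc' ccc'] := vna_adjoint Mv Mcc.
  have := sub _ (DE c c' cc Mc' ccc') eta.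
  by rewrite pE dotBl (adjoint_sym ccc') lerBlDr -lerBlDl.
clearbody p.
have psym : is_adjoint p p by exact: positive_sym.
have pnorm eta : '[p eta, p eta] = '[p eta, eta].
  apply/eqP; rewrite eq_le pmin // andbT.
  by have := positive_norm pl pp p1 eta; rewrite hnormE mul1r.
have pidem eta : p (p eta) = p eta.
  pose t zeta := (-1) *: p (p zeta) + p zeta.
  have t0 zeta : '[t zeta, zeta] = 0.
    by rewrite /t dotDl dotZl psym pnorm mulN1r addNr.
  have : t eta = 0.
    apply: positive_form0 => // [|zeta]; last by rewrite t0.
    by apply: lin_comb => //; exact: lin_comp.
  by rewrite /t scaleN1r addrC => /eqP; rewrite subr_eq0 eq_sym => /eqP.
exists p; split=> // x [Mx xp] xxi eta.
have /bounded_opP[xl [B B0 xB]] := vna_bounded Mv Mx.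
have B1 : 0 < B + 1 by rewrite ltr_wpDl.
pose k : R[i] := ((B + 1)^-1)%:C%C.
have k0 : 0 < k by rewrite ltcR invr_gt0.
(* The scaling by 1 / (B + 1) makes c a positive contraction. *)
pose c zeta := zeta - k *: x zeta.
have Mcc : M c by apply: (vna_compl Mv (vnaZ Mv k Mx)).
have cE zeta : '[c zeta, zeta] = '[zeta, zeta] - k * '[x zeta, zeta].
  by rewrite dotBl dotZl.
have c1 zeta : '[c zeta, zeta] <= 1%:C%C * '[zeta, zeta].
  by rewrite mul1r cE gerBl mulr_ge0 // ltW.
have cp : positive c.
  move=> zeta; rewrite cE subr_ge0; apply: le_trans (_ : k * (B%:C%C * '[zeta, zeta]) <= _).
    rewrite ler_wpM2l ?(ltW k0) //; apply: le_trans (op_norm_form zeta xB).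
    by rewrite ger0_norm.
  rewrite mulrA ler_piMl ?dnorm_ge0 // -rcM lecR mulrC ler_pdivrMr // mul1r.
  by rewrite lerDl.
have cc : contr c.
  split=> //; last by rewrite /c xxi scaler0 subr0.
  by apply: positive_op_norm => //; exact: vna_lin Mcc.
apply: positive_form0 => //; apply/eqP; rewrite eq_le xp andbT.
have h : '[c (p eta), c (p eta)] <= '[c (p eta), p eta].
  by have := positive_norm (vna_lin Mv Mcc) cp c1 (p eta); rewrite mul1r hnormE.
have := le_trans (pmin c (p eta) cc) h.
by rewrite pidem cE -subr_ge0 addrAC subrr add0r oppr_ge0 pmulr_rle0.
Qed.

(** Every projection q fixing xi dominates the support projection: 1 - q is
    positive and kills xi. *)
Lemma support_of_projection xi p q : projection p -> q xi = xi -> projection q ->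
  (forall x, pos_part M x -> x xi = 0 -> forall eta, x (p eta) = 0) ->
  forall eta, q (p eta) = p eta.
Proof.
move=> pp qxi qp psupp eta; apply/eqP; rewrite eq_sym -subr_eq0; apply/eqP.
apply: (psupp (fun eta => eta - q eta)); last by rewrite qxi subrr.
exact: projection_pos (projection_compl qp).
Qed.

(** Orthogonality of the supports of two vectors, which in an abelian algebra
    amounts to the existence of one projection telling them apart. *)
Definition separated xi eta := exists p, [/\ projection p, p xi = xi & p eta = 0].

Lemma separated_sym xi eta : separated xi eta -> separated eta xi.
Proof.
move=> [p [pp pxi peta]]; exists (fun zeta => zeta - p zeta).
by split; [exact: projection_compl|rewrite peta subr0|rewrite pxi subrr].
Qed.

Definition separated_family (S : set H) :=
  forall xi eta, S xi -> S eta -> xi <> eta -> separated xi eta.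

Lemma maximal_separated_family (S0 : set H) : separated_family S0 ->
  exists S, [/\ S0 `<=` S, separated_family S &
    forall zeta, (forall xi, S xi -> separated xi zeta) -> zeta = 0].
Proof.
move=> sep0.
have [F FP Ftot|A [sepA Amax]] :=
    @Zorn_bigcup _ [set A | separated_family (S0 `|` A)].
  move=> xi eta [xi0|[X FX Xxi]] [eta0|[Y FY Yeta]]; first exact: sep0.
  - by apply: (FP _ FY); [left|right].
  - by apply: (FP _ FX); [right|left].
  - have [XY|YX] := Ftot _ _ FX FY.
      by apply: (FP _ FY); right => //; exact: XY.
    by apply: (FP _ FX); right => //; exact: YX.
exists (S0 `|` A); split=> // zeta hz.
apply/eqP; apply: contraT => /eqP z0; exfalso.
have nS : ~ (S0 `|` A) zeta.
  by move=> /hz [p [_ pz pz0]]; apply: z0; rewrite -pz.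
apply: (Amax (A `|` [set zeta])).
  split; first by move=> xi; left.
  by move=> /(_ zeta) h; apply: nS; right; apply: h; right.
have S'E xi : (S0 `|` (A `|` [set zeta])) xi -> (S0 `|` A) xi \/ xi = zeta.
  by move=> [?|[?|?]]; [left; left|left; right|right].
move=> xi eta /S'E[Sxi|->] /S'E[Seta|->] //; first exact: sepA.
  by move=> _; exact: hz.
by move=> _; apply: separated_sym; exact: hz.
Qed.

Section VectorSum.
Variable S : set H.
Hypothesis sepS : separated_family S.
Hypothesis maxS : forall zeta, (forall xi, S xi -> separated xi zeta) -> zeta = 0.

(** If x >= 0 kills the family then x p = 0 for the support p of each member, so
    p kills every vector of the range of x; by maximality this range is zero. *)
Lemma separated_family_separating x : pos_part M x ->
  (forall xi, S xi -> x xi = 0) -> forall eta, x eta = 0.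
Proof.
move=> xM x0 eta; apply: maxS => xi Sxi.
have [p [pp pxi psupp]] := support_projection xi; exists p; split=> //.
by rewrite (Mc (proj_in pp) xM.1) psupp // x0.
Qed.

Local Notation phi := (vector_sum_weight S).

(** The support of a member kills all the others, so a single term of the sum
    is left. *)
Lemma support_weight_fin xi : S xi -> exists p,
  [/\ projection p, (phi p < +oo)%E & p xi = xi].
Proof.
move=> Sxi; have [p [pp pxi psupp]] := support_projection xi; exists p; split=> //.
have pM := projection_pos pp.
rewrite /vector_sum_weight (esumID [set xi]); last by move=> eta _; exact: Re_form_ge0 _ pM.
rewrite [X in (_ + X)%E]esum1; last first.
  move=> eta [Seta /= ne]; have [q [qp qxi qeta]] : separated xi eta.
    by apply: sepS => // e; exact: ne.
  rewrite -(support_of_projection pp qxi qp psupp) (Mc (proj_in qp) (proj_in pp)).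
  by rewrite qeta (lin0 (vna_lin Mv (proj_in pp))) dot0l.
have -> : S `&` [set xi] = [set xi] by apply/seteqP; split=> [?[]|? ->].
by rewrite adde0 esum_set1 ?ltry // (Re_form_ge0 _ pM).
Qed.

(** The join is p + q - p q, the complement of (1 - p) (1 - q). *)
Lemma projection_join p q : projection p -> projection q ->
  exists r, [/\ projection r, op_le p r, op_le q r &
    forall xi, '[r xi, xi] <= '[p xi, xi] + '[q xi, xi]].
Proof.
move=> pp qp; have [pM ps pi] := pp; have [qM qs qi] := qp.
pose p' xi := xi - p xi; pose q' xi := xi - q xi.
have pp' : projection p' := projection_compl pp.
have qp' : projection q' := projection_compl qp.
have comp : projection (p' \o q').
  have [pM' ps' pi'] := pp'; have [qM' qs' qi'] := qp'.
  split=> [|xi eta|xi] /=; first exact: vna_comp.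
    by rewrite ps' qs' (Mc qM' pM').
  by rewrite (Mc qM' pM') pi' qi'.
have sand a b xi : projection a -> projection b ->
    '[a (b xi), xi] = '[b (a xi), a xi].
  move=> pa pb; rewrite -(proj_idem pa (b xi)) (Mc (proj_in pa) (proj_in pb) xi).
  exact: proj_sym.
have pq_le a b xi : projection a -> projection b -> '[a (b xi), xi] <= '[a xi, xi].
  move=> pa pb; rewrite (sand a b xi pa pb) [leRHS]projection_form //.
  exact: (projection_le1 pb (a xi)).
have rE xi : '[xi - p' (q' xi), xi] = '[xi, xi] - '[p' (q' xi), xi] by rewrite dotBl.
exists (fun xi => xi - p' (q' xi)); split.
- exact: projection_compl comp.
- by move=> xi; rewrite rE lerBrDr -lerBrDl -dotBl; exact: pq_le.
- move=> xi; rewrite rE lerBrDr -lerBrDl -dotBl (Mc (proj_in pp') (proj_in qp')).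
  exact: pq_le.
- move=> xi; rewrite rE.
  have -> : '[p' (q' xi), xi] = '[xi, xi] - '[q xi, xi] - ('[p xi, xi] - '[p (q xi), xi]).
    by rewrite /p' /q' (linB (vna_lin Mv pM)) !dotBl.
  have : 0 <= '[p (q xi), xi] by rewrite (sand p q xi pp qp); exact: (projection_pos qp).2.
  rewrite -subr_ge0 => h; rewrite -subr_ge0; move: h; congr (_ <= _); ring.
Qed.

Let finite_proj := [set p | projection p /\ (phi p < +oo)%E].

Let finite_proj_pos : finite_proj `<=` pos_part M.
Proof. by move=> p [/projection_pos]. Qed.

Let finite_proj0 : finite_proj !=set0.
Proof.
exists (fun=> 0); split.
  split=> [|xi eta|//]; last by rewrite dot0l dot0r.
  have := vna_compl Mv (vna_id Mv); congr M.
  by apply/funext => xi; rewrite subrr.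
by rewrite /vector_sum_weight esum1 // => xi _; rewrite dot0l.
Qed.

Let finite_proj_directed : directed finite_proj.
Proof.
move=> p q [pp pf] [qp qf]; have [r [rp pr qr rle]] := projection_join pp qp.
exists r; split=> //; split=> //.
have [pM qM] := (projection_pos pp, projection_pos qp).
apply: le_lt_trans (_ : (phi p + phi q < +oo)%E); last by rewrite lte_add_pinfty.
rewrite -(weightD (vector_sum_weightP M S)) //; apply: op_le_vector_sum => xi.
by rewrite dotDl.
Qed.

(** The supremum s of the projections of finite weight dominates the support of
    each member of the family, so 1 - s kills the family and vanishes. *)
Let finite_proj_sup : is_pos_sup M finite_proj id.
Proof.
have DB d : finite_proj d -> forall xi, '[d xi, xi] <= 1%:C%C * '[xi, xi].
  by move=> [dp _] xi; rewrite mul1r; exact: projection_le1.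
have [s [[Ms sp] sub slub _]] :=
  monotone_limit Mv ler01 finite_proj_pos finite_proj0 finite_proj_directed DB.
have sid : s = id.
  suff c0 eta : eta - s eta = 0.
    by apply/funext => eta; apply/eqP; rewrite eq_sym -subr_eq0 c0.
  have cM : pos_part M (fun eta => eta - s eta).
    split=> [|xi]; first exact: vna_compl.
    rewrite dotBl subr_ge0; apply: slub => d Dd zeta.
    by have := DB d Dd zeta; rewrite mul1r.
  apply: (separated_family_separating cM) => xi Sxi.
  apply: (positive_form0 (x := fun eta => eta - s eta)); [exact: (vna_lin Mv cM.1)|exact: cM.2|].
  have [p [pp pf pxi]] := support_weight_fin Sxi.
  apply/eqP; rewrite eq_le cM.2 andbT dotBl subr_le0 -{1}pxi.
  exact: (sub p (conj pp pf)).
split; last by move=> z zM hz; rewrite -sid; exact: slub.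
  by split=> [|xi]; [exact: vna_id|exact: dnorm_ge0].
by move=> d [dp _]; exact: projection_le1.
Qed.

(** A normal functional is continuous along the net of projections of finite
    weight, and directedness handles finitely many functionals at once. *)
Lemma finite_projections_exhaust (n : nat) (rho : 'I_n -> (H -> H) -> R[i]) (del : R) :
  (forall i, predual_pos M (rho i)) -> 0 < del ->
  exists q, finite_proj q /\
    forall i, complex.Re (rho i (fun xi => xi - q xi)) < del.
Proof.
move=> rhoP del0.
have rhoB i x y : M x -> M y ->
    rho i (fun xi => y xi - x xi) = rho i y - rho i x.
  move=> Mx My; have := pp_linear (rhoP i) (-1) Mx My.
  rewrite mulN1r addrC => <-; congr (rho i).
  by apply/funext => xi; rewrite scaleN1r addrC.
have one i : exists q, finite_proj q /\
    complex.Re (rho i (fun xi => xi - q xi)) < del.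
  have := pp_normal (rhoP i) finite_proj_pos finite_proj0 finite_proj_directed finite_proj_sup.
  set E := [set _ | _ in _] => supE.
  have : ((complex.Re (rho i id) - del)%:E < ereal_sup E)%E.
    by rewrite -supE lte_fin gtrBl.
  move=> /ereal_sup_gt [_ [q qF <-]]; rewrite lte_fin => hq; exists q; split=> //.
  rewrite rhoB; [|exact: (proj_in qF.1)|exact: vna_id].
  by rewrite ReB ltrBlDr -ltrBlDl.
suff all_list (s : seq 'I_n) : exists q, finite_proj q /\
    forall i, i \in s -> complex.Re (rho i (fun xi => xi - q xi)) < del.
  have [q [qF hq]] := all_list (enum 'I_n); exists q; split=> // i.
  by apply: hq; rewrite mem_enum.
elim: s => [|i s [q [qF hq]]]; first by have [q qF] := finite_proj0; exists q.
have [q' [q'F hq']] := one i.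
have [r [rF qr q'r]] := finite_proj_directed qF q'F.
have mono t k : finite_proj t -> op_le t r ->
    complex.Re (rho k (fun xi => xi - r xi)) <= complex.Re (rho k (fun xi => xi - t xi)).
  move=> tF tr; have [tM rM] := (proj_in tF.1, proj_in rF.1).
  rewrite !(rhoB, ReB) //; try exact: vna_id.
  rewrite lerD2l lerN2 -subr_ge0 -ReB -rhoB //.
  apply: Re_ge0; apply: (pp_pos (rhoP k)); split=> [|xi]; last by rewrite dotBl subr_ge0.
  have := vna_linear Mv (-1) tM rM; congr M.
  by apply/funext => xi; rewrite scaleN1r addrC.
exists r; split=> // k; rewrite in_cons => /predU1P[->|ks].
  by apply: le_lt_trans hq'; exact: mono.
by apply: le_lt_trans (hq k ks); exact: mono.
Qed.

Lemma square_finite_proj x q : M x -> finite_proj q -> square_finite M phi (x \o q).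
Proof.
move=> Mx [qp qf]; have [qM qs qi] := qp; split; first exact: vna_comp.
have [x' Mx' xx'] := vna_adjoint Mv Mx.
exists (q \o x'); split; first exact: vna_comp.
  by move=> xi eta /=; rewrite xx' qs.
have /bounded_opP[xl [B B0 xB]] := vna_bounded Mv Mx.
apply: le_lt_trans (_ : (B ^+ 2)%:E * phi q < +oo)%E; last first.
  by rewrite lte_mul_pinfty // lee_fin exprn_ge0.
rewrite -ge0_esumZl ?exprn_ge0 //; last first.
  by move=> xi _; exact: Re_form_ge0 _ (projection_pos qp).
apply: le_esum => xi _ /=; rewrite -EFinM lee_fin -ReZ; apply: Re_le.
rewrite qs (adjoint_sym xx') [in leRHS]projection_form // -!hnormE.
rewrite rmorphXn /= -exprMn ler_pXn2r ?nnegrE ?mulr_ge0 ?lecR //.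
Qed.

(** The approximants of x are x q with q a projection of finite weight:
    Cauchy-Schwarz bounds |rho (x - x q)|^2 by a multiple of rho (1 - q). *)
Lemma vector_sum_semifinite : semifinite M phi.
Proof.
move=> x Mx n rho rhoP e e0.
have [x' Mx' xx'] := vna_adjoint Mv Mx.
pose K := \sum_i complex.Re (rho i (x \o x')).
have K0 i : 0 <= complex.Re (rho i (x \o x')).
  apply: Re_ge0; apply: (pp_pos (rhoP i)); split=> [|xi /=]; first exact: vna_comp.
  by rewrite xx' dnorm_ge0.
have K1 : 0 < K + 1 by rewrite ltr_wpDl // sumr_ge0.
have del0 : 0 < e ^+ 2 / (K + 1) by rewrite divr_gt0 // exprn_gt0.
have [q [qF hq]] := finite_projections_exhaust rhoP del0.
exists (x \o q); first exact: square_finite_proj.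
move=> i; have [qp qf] := qF; have [qM _ _] := qp.
pose r xi := xi - q xi; have rp : projection r by exact: projection_compl.
have [rM rs ri] := rp.
have -> : rho i x - rho i (x \o q) = rho i (x \o r).
  have := pp_linear (rhoP i) (-1) (vna_comp Mv Mx qM) Mx.
  rewrite mulN1r addrC => <-; congr (rho i); apply/funext => xi.
  by rewrite /r /= scaleN1r (linB (vna_lin Mv Mx)) addrC.
rewrite -(ltr_pXn2r (n := 2)) ?nnegrE ?normr_ge0 ?lecR ?(ltW e0) //.
apply: le_lt_trans (predual_cauchy_schwarz Mv (rhoP i) Mx Mx' xx' rM rs ri) _.
have r0 := pp_pos (rhoP i) (projection_pos rp).
have xx0 : 0 <= rho i (x \o x').
  apply: (pp_pos (rhoP i)); split=> [|xi /=]; first exact: vna_comp.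
  by rewrite xx' dnorm_ge0.
rewrite -(ge0_ReK r0) -(ge0_ReK xx0) -rcM -rmorphXn /= ltcR.
apply: le_lt_trans (_ : (K + 1) * complex.Re (rho i r) < _).
  rewrite ler_wpM2r ?Re_ge0 //; apply: le_trans (_ : K <= _); last by rewrite lerDl.
  by rewrite /K (bigD1 i) //= lerDl sumr_ge0.
by rewrite mulrC -ltr_pdivlMr //; exact: hq.
Qed.

Theorem vector_sum_nsf : nsf_weight M phi.
Proof.
split; [exact: vector_sum_weightP|exact: vector_sum_normal|exact: vector_sum_semifinite|].
move=> x xM x0; apply: (separated_family_separating xM) => xi Sxi.
apply: positive_form0; [exact: (vna_lin Mv xM.1)|exact: xM.2|].
have h : ((complex.Re '[x xi, xi])%:E <= phi x)%E.
  apply: esum_ge; exists [set xi]; last by rewrite fsbig_set1.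
  by split; [exact: finite_set1|move=> _ ->].
have r0 : complex.Re '[x xi, xi] = 0.
  apply/eqP; rewrite eq_le (Re_ge0 (xM.2 xi)) andbT.
  by move: h; rewrite x0 lee_fin.
by rewrite -(ge0_ReK (xM.2 xi)) r0.
Qed.

End VectorSum.
End AbelianWeights.

(** * The strong closure of a commutative star-algebra *)

Section StrongClosure.
Variables (R : realType) (H : hilbert R).
Implicit Types (x y z a b : H -> H) (xi eta zeta : H).
Variables (A : set (H -> H)) (J : H -> H).
Hypothesis A_bounded : A `<=` @bounded_op R H.

Lemma sot_approx x (s : seq H) (e : R[i]) : sot_closure A x -> 0 < e ->
  exists2 a, A a & forall xi, xi \in s -> `|x xi - a xi| < e.
Proof. by move=> [_ /ptws_closureP xA]; exact: xA. Qed.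

Lemma sot_closureI x : bounded_op x ->
  (forall (s : seq H) (e : R[i]), 0 < e ->
    exists2 a, A a & forall xi, xi \in s -> `|x xi - a xi| < e) ->
  sot_closure A x.
Proof. by move=> xb xA; split=> //; apply/ptws_closureP. Qed.

Lemma sub_sot_closure : A `<=` sot_closure A.
Proof.
move=> a Aa; apply: sot_closureI; first exact: A_bounded.
by move=> s e e0; exists a => // xi _; rewrite subrr normr0.
Qed.

Lemma sot_closure_idem : sot_closure (sot_closure A) `<=` sot_closure A.
Proof.
move=> x [xb /ptws_closureP xA]; apply: sot_closureI => // s e e0.
have e20 : 0 < e / 2 by rewrite divr_gt0.
have [y yA xy] := xA s _ e20; have [a Aa ya] := sot_approx s yA e20.
exists a => // xi xis; rewrite -(subrKA (y xi)).
by rewrite (le_lt_trans (ler_normD _ _)) // [ltRHS]splitr ltrD // ?xy ?ya.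
Qed.

Lemma bounded_op_dist x : bounded_op x -> exists2 B : R[i], 0 < B &
  forall xi eta, `|x xi - x eta| <= B * `|xi - eta|.
Proof.
move=> /bounded_opP[xl [B B0 xB]]; exists (B%:C%C + 1); first by rewrite ltr_wpDl ?lecR.
move=> xi eta; rewrite -(linB xl); apply: le_trans (xB _) _.
by rewrite ler_wpM2r // lerDl.
Qed.

Hypothesis A_comb : forall (c : R[i]) a b, A a -> A b -> A (fun xi => c *: a xi + b xi).
Hypothesis A_comp : forall a b, A a -> A b -> A (a \o b).
Hypothesis A_id : A id.
Hypothesis J_antilinear : forall (c : R[i]) xi eta,
  J (c *: xi + eta) = c^* *: J xi + J eta.
Hypothesis J_isometry : forall xi, `|J xi| = `|xi|.
Hypothesis A_conj : forall a, A a -> A (J \o a \o J) /\ is_adjoint a (J \o a \o J).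
Hypothesis A_comm : forall a b, A a -> A b -> forall xi, a (b xi) = b (a xi).

Let J_dist xi eta : `|J xi - J eta| = `|xi - eta|.
Proof.
rewrite -[RHS]J_isometry; congr `|_|.
have := J_antilinear (-1) eta xi.
by rewrite rmorphN rmorph1 !scaleN1r ![- _ + _]addrC => ->.
Qed.

Lemma sot_closure_linear (c : R[i]) x y : sot_closure A x -> sot_closure A y ->
  sot_closure A (fun xi => c *: x xi + y xi).
Proof.
move=> xA yA; apply: sot_closureI; first exact: bounded_op_comb xA.1 yA.1.
move=> s e e0; have e20 : 0 < e / 2 by rewrite divr_gt0.
have c1 : 0 < `|c| + 1 by rewrite ltr_wpDl.
have [a Aa xa] := sot_approx s xA (divr_gt0 e20 c1).
have [b Ab yb] := sot_approx s yA e20.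
exists (fun xi => c *: a xi + b xi); first exact: A_comb.
move=> xi xis; rewrite opprD addrACA -scalerBr.
rewrite (le_lt_trans (ler_normD _ _)) // [ltRHS]splitr ler_ltD ?yb //.
rewrite normrZ; apply: le_trans (_ : (`|c| + 1) * `|x xi - a xi| <= _).
  by rewrite ler_wpM2r // lerDl.
by rewrite mulrC -ler_pdivlMr // ltW // xa.
Qed.

Lemma sot_closure_comp x y : sot_closure A x -> sot_closure A y ->
  sot_closure A (x \o y).
Proof.
move=> xA yA; apply: sot_closureI; first exact: bounded_op_comp xA.1 yA.1.
move=> s e e0; have e20 : 0 < e / 2 by rewrite divr_gt0.
have [a Aa xa] := sot_approx (map y s) xA e20.
have [B B0 aB] := bounded_op_dist (A_bounded Aa).
have [b Ab yb] := sot_approx s yA (divr_gt0 e20 B0).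
exists (a \o b); first exact: A_comp.
move=> xi xis /=; rewrite -(subrKA (a (y xi))).
rewrite (le_lt_trans (ler_normD _ _)) // [ltRHS]splitr ltr_leD //.
  by apply: xa; exact: map_f.
by apply: le_trans (aB _ _) _; rewrite mulrC -ler_pdivlMr // ltW // yb.
Qed.

Lemma sot_closure_conj x : sot_closure A x -> sot_closure A (J \o x \o J).
Proof.
move=> xA; have /bounded_opP[xl [B B0 xB]] := xA.1.
apply: sot_closureI.
  split; last by exists B => xi /=; rewrite J_isometry -[in leRHS]J_isometry.
  by move=> c xi eta /=; rewrite J_antilinear xl J_antilinear conjCK.
move=> s e e0; have [a Aa xa] := sot_approx (map J s) xA e0.
exists (J \o a \o J); first by have [] := A_conj Aa.
by move=> xi xis /=; rewrite J_dist; apply: xa; exact: map_f.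
Qed.

(** Passing to adjoints is not strongly continuous in general; here the adjoint
    is x |-> J x J, and J is isometric. *)
Lemma sot_closure_adjoint x : sot_closure A x -> is_adjoint x (J \o x \o J).
Proof.
move=> xA xi eta; apply/eqP; rewrite -subr_eq0; apply/eqP; apply: approx_eq0 => e e0.
have n0 : 0 < `|xi| + `|eta| + 1 by rewrite ltr_wpDl // addr_ge0.
have [a Aa xa] := sot_approx [:: xi; J eta] xA (divr_gt0 e0 n0).
have [_ aJ] := A_conj Aa.
have -> : '[x xi, eta] - '[xi, (J \o x \o J) eta] =
    '[x xi - a xi, eta] - '[xi, J (x (J eta)) - J (a (J eta))].
  by rewrite dotBl dotBr aJ /=; ring.
rewrite (le_trans (ler_normB _ _)) //.
have h1 : `|x xi - a xi| <= e / (`|xi| + `|eta| + 1) by rewrite ltW // xa // mem_head.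
have h2 : `|x (J eta) - a (J eta)| <= e / (`|xi| + `|eta| + 1).
  by rewrite ltW // xa // !inE eqxx orbT.
apply: le_trans (_ : e / (`|xi| + `|eta| + 1) * `|eta| + `|xi| * (e / (`|xi| + `|eta| + 1)) <= _).
  apply: lerD; apply: le_trans (hilbert_cauchy_schwarz _ _) _.
    by rewrite ler_wpM2r.
  by rewrite J_dist ler_wpM2l.
rewrite mulrC -mulrDl mulrA ler_pdivrMr // mulrC ler_wpM2l ?(ltW e0) //.
by rewrite addrC lerDl.
Qed.

Lemma sot_closure_commutative x y : sot_closure A x -> sot_closure A y ->
  forall xi, x (y xi) = y (x xi).
Proof.
have half a z : A a -> sot_closure A z -> forall xi, a (z xi) = z (a xi).
  move=> Aa zA xi; apply: approx_vec_eq => e e0.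
  have [B B0 aB] := bounded_op_dist (A_bounded Aa).
  have n0 : 0 < B + 1 by rewrite addr_gt0.
  have [b Ab zb] := sot_approx [:: xi; a xi] zA (divr_gt0 e0 n0).
  rewrite -(subrKA (a (b xi))) (A_comm Aa Ab) -(A_comm Aa Ab).
  rewrite [X in `|_ + (X - _)|](A_comm Aa Ab) (le_trans (ler_normD _ _)) //.
  have h1 := ltW (zb xi (mem_head _ _)).
  have h2 : `|z (a xi) - b (a xi)| <= e / (B + 1) by rewrite ltW // zb // !inE eqxx orbT.
  apply: le_trans (_ : B * (e / (B + 1)) + e / (B + 1) <= _); last first.
    by rewrite -[X in _ + X]mul1r -mulrDl mulrCA divff ?mulr1 // gt_eqF.
  apply: lerD; last by rewrite distrC.
  by apply: le_trans (aB _ _) _; rewrite ler_wpM2l // ltW.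
move=> xA yA xi; apply: approx_vec_eq => e e0.
have [B B0 yB] := bounded_op_dist yA.1.
have n0 : 0 < 1 + B by rewrite addr_gt0.
have [a Aa xa] := sot_approx [:: xi; y xi] xA (divr_gt0 e0 n0).
rewrite -(subrKA (a (y xi))) [X in `|_ + (X - _)|](half _ _ Aa yA).
have h1 := ltW (xa xi (mem_head _ _)).
have h2 : `|x (y xi) - a (y xi)| <= e / (1 + B) by rewrite ltW // xa // !inE eqxx orbT.
rewrite (le_trans (ler_normD _ _)) //.
apply: le_trans (_ : e / (1 + B) + B * (e / (1 + B)) <= _); last first.
  by rewrite -[X in X + _]mul1r -mulrDl mulrCA divff ?mulr1 // gt_eqF.
apply: lerD => //; apply: le_trans (yB _ _) _.
by rewrite ler_wpM2l ?(ltW B0) // distrC.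
Qed.

(** Multiplication is continuous in each variable separately, which suffices to
    carry products to the closure one factor at a time. *)
Lemma sot_closure_vna : von_neumann_algebra (sot_closure A).
Proof.
split.
- by move=> x [].
- exact: sub_sot_closure.
- exact: sot_closure_linear.
- exact: sot_closure_comp.
- by move=> x xA; exists (J \o x \o J); [exact: sot_closure_conj|exact: sot_closure_adjoint].
- exact: sot_closure_idem.
Qed.

End StrongClosure.

(** * Ultraproducts of abelian von Neumann algebras *)

Section UltraVectors.
Variables (R : realType) (w : free_ultrafilter) (H_ : nat -> hilbert R).
Local Notation K := (hilbert_ultraproduct w H_).
Implicit Types (xi eta : forall j, H_ j).

Lemma ulim_norm_le (u v : nat -> R[i]) : bounded_scal u -> bounded_scal v ->
  (forall j, u j <= v j) -> ulim w u <= ulim w v.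
Proof.
move=> ub vb uv; rewrite -subr_ge0.
have nb : bounded_scal (fun j => -1 * u j).
  by have [B uB] := ub; exists B => j; rewrite mulN1r normrN.
rewrite -mulN1r -ulimZ // -ulimD //; apply: ulim_ge0.
  have [B uB] := nb; have [B' vB] := vb; exists (B' + B) => j.
  by rewrite rcD (le_trans (ler_normD _ _)) // lerD.
by move=> j; rewrite mulN1r subr_ge0.
Qed.

Lemma ultra_vec_ind (P : K -> Prop) :
  (forall xi, bounded_seq xi -> P (ultra_vec w xi)) -> forall k, P k.
Proof. by move=> h k; have [xi bxi <-] := ultra_vec_surj k; exact: h. Qed.

Lemma bounded_seq_comb (a : R[i]) xi eta : bounded_seq xi -> bounded_seq eta ->
  bounded_seq (fun j => a *: xi j + eta j).
Proof. by move=> bx be; exact: bfunP (a *: BSeq bx + BSeq be). Qed.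

Lemma ultra_vec_comb (a : R[i]) xi eta : bounded_seq xi -> bounded_seq eta ->
  ultra_vec w (fun j => a *: xi j + eta j) = a *: ultra_vec w xi + ultra_vec w eta.
Proof.
move=> bx be; rewrite (ultra_vecE w (BSeq bx)) (ultra_vecE w (BSeq be)).
rewrite (ultra_vecE w (a *: BSeq bx + BSeq be)).
by rewrite uclD uclZ.
Qed.

Lemma ultra_vec_norm xi : bounded_seq xi -> `|ultra_vec w xi| = ulim w (fun j => `|xi j|).
Proof. by move=> bx; rewrite (ultra_vecE w (BSeq bx)); exact: unorm_ucl. Qed.

Lemma bounded_seq_lip (f : forall j, H_ j -> H_ j) (B : R) xi :
  (forall j u, `|f j u| <= B%:C%C * `|u|) -> bounded_seq xi ->
  bounded_seq (fun j => f j (xi j)).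
Proof.
move=> fB [B' hB']; exists (`|B| * B') => j.
apply: le_trans (fB j _) _; rewrite rcM.
apply: le_trans (_ : `|B|%:C%C * `|xi j| <= _).
  by rewrite ler_wpM2r // lecR ler_norm.
by rewrite ler_wpM2l // lecR.
Qed.

(** Uniformly Lipschitz maps, linear or not, act on classes of bounded sequences;
    this covers the antilinear conjugations. *)
Lemma ultra_op_lip (f : forall j, H_ j -> H_ j) (B : R) xi :
  (forall j u, `|f j u| <= B%:C%C * `|u|) ->
  (forall j u v, `|f j u - f j v| <= B%:C%C * `|u - v|) -> bounded_seq xi ->
  ultra_op f (ultra_vec w xi) = ultra_vec w (fun j => f j (xi j)).
Proof.
move=> fB fL bx; have bf := bounded_seq_lip fB.
rewrite /ultra_op (ultra_vecE w (BSeq bx)).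
rewrite (ultra_vecE w (BSeq (bf _ (bfunP (repr (ucl w (BSeq bx))))))).
rewrite (ultra_vecE w (BSeq (bf _ bx))).
apply/uclP => /=.
apply: (@ulim_squeeze _ w _ (fun j => `|repr (ucl w (BSeq bx)) j - xi j|) B).
- exact: (bounded_norm (repr (ucl w (BSeq bx)) - BSeq bx)).
- exact: (repr_ucl w (BSeq bx)).
- by move=> j; rewrite normr_id.
Qed.

End UltraVectors.

Section AbelianUltraproduct.
Variables (R : realType) (w : free_ultrafilter) (H_ : nat -> hilbert R).
Variables (M_ : forall j, set (H_ j -> H_ j)) (J_ : forall j, H_ j -> H_ j).
Arguments M_ : clear implicits.
Arguments J_ : clear implicits.
Local Notation K := (hilbert_ultraproduct w H_).
Hypothesis M_vna : forall j, von_neumann_algebra (M_ j).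
Hypothesis M_comm : forall j a b, M_ j a -> M_ j b -> forall xi, a (b xi) = b (a xi).
Hypothesis J_antilinear : forall j (c : R[i]) (xi eta : H_ j),
  J_ j (c *: xi + eta) = c^* *: J_ j xi + J_ j eta.
Hypothesis J_isometry : forall j (xi : H_ j), `|J_ j xi| = `|xi|.
Hypothesis M_conj : forall j a, M_ j a ->
  M_ j (J_ j \o a \o J_ j) /\ is_adjoint a (J_ j \o a \o J_ j).

Lemma bounded_op_seqP a : bounded_op_seq M_ a ->
  (forall j, M_ j (a j)) /\ (forall j, linear (a j)) /\
  exists2 B : R, 0 <= B & forall j, op_norm_le (a j) B.
Proof.
move=> [aM [B aB]]; split=> //; split=> [j|]; first exact: vna_lin (aM j).
exists `|B| => // j xi; apply: le_trans (aB j xi) _.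
by rewrite ler_wpM2r // lecR ler_norm.
Qed.

Lemma bounded_seq_op a xi : bounded_op_seq M_ a -> bounded_seq xi ->
  bounded_seq (fun j => a j (xi j)).
Proof. by move=> /bounded_op_seqP[_ [_ [B _ aB]]]; exact: (bounded_seq_lip aB). Qed.

Lemma ultra_op_vec a xi : bounded_op_seq M_ a -> bounded_seq xi ->
  ultra_op a (ultra_vec w xi) = ultra_vec w (fun j => a j (xi j)).
Proof. by move=> /bounded_op_seqP[_ [al [B _ aB]]]; exact: ultra_opE. Qed.

Lemma ultra_conj_vec xi : bounded_seq xi ->
  ultra_op J_ (ultra_vec w xi) = ultra_vec w (fun j => J_ j (xi j)) /\
  bounded_seq (fun j => J_ j (xi j)).
Proof.
move=> bx.
have h j u : `|J_ j u| <= 1%:C%C * `|u| by rewrite J_isometry mul1r.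
split; last exact: bounded_seq_lip h bx.
apply: ultra_op_lip h _ bx => j u v; rewrite mul1r -[leRHS]J_isometry.
have := J_antilinear (-1) v u.
by rewrite rmorphN rmorph1 !scaleN1r ![- _ + _]addrC => ->.
Qed.

(* The algebra whose strong closure is the ultraproduct. *)
Let A : set (K -> K) := [set ultra_op a | a in bounded_op_seq M_].

Let A_bounded : A `<=` @bounded_op R K.
Proof.
move=> _ [a aP <-]; have [aM [al [B B0 aB]]] := bounded_op_seqP aP.
split.
  move=> c; elim/ultra_vec_ind => xi bx; elim/ultra_vec_ind => eta be.
  rewrite -ultra_vec_comb // !ultra_op_vec //; last exact: bounded_seq_comb.
  rewrite -ultra_vec_comb; [|exact: bounded_seq_op..].
  by congr (ultra_vec w _); apply: functional_extensionality_dep => j; rewrite al.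
exists B; elim/ultra_vec_ind => xi bx.
rewrite ultra_op_vec // !ultra_vec_norm //; last exact: bounded_seq_op.
have bn := bounded_norm (BSeq bx).
rewrite -ulimZ //; apply: ulim_norm_le => //.
- exact: (bounded_norm (BSeq (bounded_seq_op aP bx))).
- have [B' hB'] := bn; exists (B * B') => j.
  have B0C : 0 <= B%:C%C by rewrite lecR.
  rewrite rcM normrM (ger0_norm B0C) ler_wpM2l //; exact: hB'.
- by move=> j; exact: aB.
Qed.

Let A_comb (c : R[i]) a b : A a -> A b -> A (fun xi => c *: a xi + b xi).
Proof.
move=> [x xP <-] [y yP <-].
have [xM [xl [B B0 xB]]] := bounded_op_seqP xP.
have [yM [yl [B' B'0 yB]]] := bounded_op_seqP yP.
have zP : bounded_op_seq M_ (fun j u => c *: x j u + y j u).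
  split=> [j|]; first exact: vna_linear.
  exists (complex.Re `|c| * B + B') => j u.
  rewrite (le_trans (ler_normD _ _)) // rcD rcM ge0_ReK //.
  by rewrite mulrDl lerD // ?yB // normrZ -mulrA ler_wpM2l // xB.
exists (fun j u => c *: x j u + y j u) => //.
apply/funext; elim/ultra_vec_ind => xi bx.
by rewrite !ultra_op_vec // ultra_vec_comb //; exact: bounded_seq_op.
Qed.

Let comp_seq x y : bounded_op_seq M_ x -> bounded_op_seq M_ y ->
  bounded_op_seq M_ (fun j => x j \o y j).
Proof.
move=> xP yP.
have [xM [xl [B B0 xB]]] := bounded_op_seqP xP.
have [yM [yl [B' B'0 yB]]] := bounded_op_seqP yP.
split=> [j|]; first exact: vna_comp.
exists (B * B') => j u; apply: le_trans (xB _ _) _.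
by rewrite rcM -mulrA ler_wpM2l ?lecR // yB.
Qed.

Lemma ultra_op_comp x y : bounded_op_seq M_ x -> bounded_op_seq M_ y ->
  ultra_op (fun j => x j \o y j) = ultra_op x \o ultra_op y :> (K -> K).
Proof.
move=> xP yP; apply/funext; elim/ultra_vec_ind => xi bx /=.
rewrite (ultra_op_vec (comp_seq xP yP)) // !ultra_op_vec //.
exact: bounded_seq_op.
Qed.

Let A_comp a b : A a -> A b -> A (a \o b).
Proof.
move=> [x xP <-] [y yP <-]; exists (fun j => x j \o y j); first exact: comp_seq.
exact: ultra_op_comp.
Qed.

Lemma bounded_op_seq_id : bounded_op_seq M_ (fun=> id).
Proof.
split=> [j|]; first exact: vna_id.
by exists 1 => j u; rewrite mul1r.
Qed.

Let A_id : A id.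
Proof.
exists (fun=> id); first exact: bounded_op_seq_id.
apply/funext; elim/ultra_vec_ind => xi bx.
by rewrite (ultra_op_vec bounded_op_seq_id).
Qed.

Let JK : K -> K := ultra_op J_.

Let JK_antilinear (c : R[i]) (xi eta : K) : JK (c *: xi + eta) = c^* *: JK xi + JK eta.
Proof.
move: xi eta; elim/ultra_vec_ind => xi bx; elim/ultra_vec_ind => eta be.
rewrite /JK -ultra_vec_comb //.
have [-> bxi] := ultra_conj_vec bx; have [-> beta] := ultra_conj_vec be.
have [-> _] := ultra_conj_vec (bounded_seq_comb c bx be).
rewrite -ultra_vec_comb //.
by congr (ultra_vec w _); apply: functional_extensionality_dep => j; rewrite J_antilinear.
Qed.

Let JK_isometry (xi : K) : `|JK xi| = `|xi|.
Proof.
elim/ultra_vec_ind: xi => xi bx; rewrite /JK; have [-> bxi] := ultra_conj_vec bx.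
by rewrite !ultra_vec_norm //; congr (ulim w _); apply/funext => j.
Qed.

Let A_conj a : A a -> A (JK \o a \o JK) /\ is_adjoint a (JK \o a \o JK).
Proof.
move=> [x xP <-].
have [xM [xl [B B0 xB]]] := bounded_op_seqP xP.
have yP : bounded_op_seq M_ (fun j => J_ j \o x j \o J_ j).
  split=> [j|]; first by have [] := M_conj (xM j).
  by exists B => j u /=; rewrite J_isometry -[in leRHS]J_isometry; exact: xB.
have yE (xi : forall j, H_ j) : bounded_seq xi ->
    (JK \o ultra_op x \o JK) (ultra_vec w xi) = ultra_vec w (fun j => J_ j (x j (J_ j (xi j)))).
  move=> bx; rewrite /JK /=; have [-> bxi] := ultra_conj_vec bx.
  by rewrite ultra_op_vec //; have [-> _] := ultra_conj_vec (bounded_seq_op xP bxi).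
split.
  exists (fun j => J_ j \o x j \o J_ j) => //.
  by apply/funext; elim/ultra_vec_ind => xi bx; rewrite yE // ultra_op_vec.
elim/ultra_vec_ind => xi bx; elim/ultra_vec_ind => eta be.
rewrite yE // ultra_op_vec // !ultra_vec_dot //.
- by congr (ulim w _); apply/funext => j; rewrite (M_conj (xM j)).2.
- exact: bounded_seq_op yP be.
- exact: bounded_seq_op.
Qed.

Let A_comm a b : A a -> A b -> forall xi, a (b xi) = b (a xi).
Proof.
move=> [x xP <-] [y yP <-]; elim/ultra_vec_ind => xi bx.
rewrite [ultra_op y _]ultra_op_vec // [ultra_op x (ultra_vec w xi)]ultra_op_vec //.
rewrite (ultra_op_vec xP (bounded_seq_op yP bx)) (ultra_op_vec yP (bounded_seq_op xP bx)).
congr (ultra_vec w _); apply: functional_extensionality_dep => j.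
exact: M_comm (xP.1 j) (yP.1 j) _.
Qed.

Lemma ultra_op_groh_raynaud x : bounded_op_seq M_ x -> groh_raynaud w M_ (ultra_op x).
Proof. by move=> xP; apply: (sub_sot_closure A_bounded); exists x. Qed.

Lemma groh_raynaud_vna : von_neumann_algebra (groh_raynaud w M_).
Proof.
exact: (sot_closure_vna A_bounded A_comb A_comp A_id JK_antilinear JK_isometry A_conj).
Qed.

Lemma groh_raynaud_commutative x y : groh_raynaud w M_ x -> groh_raynaud w M_ y ->
  forall xi, x (y xi) = y (x xi).
Proof. exact: (sot_closure_commutative A_bounded A_comm). Qed.

End AbelianUltraproduct.

(** * Diagonal operators on a finite-dimensional space *)

(** An abelian M is contained in its commutant, so all of M is central and the
    axiom on the center says that x |-> J x J is the adjoint. *)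
Lemma standard_form_conj (R : realType) (H : hilbert R) (M : set (H -> H)) J P :
  standard_form M J P -> (forall x y, M x -> M y -> forall xi, x (y xi) = y (x xi)) ->
  forall a, M a -> M (J \o a \o J) /\ is_adjoint a (J \o a \o J).
Proof.
move=> sf Mc a Ma; have Mv := sf_vna sf.
have adj : is_adjoint a (J \o a \o J).
  apply: (sf_center sf) => //; split; first exact: (vna_bounded Mv Ma).
  by move=> x Mx xi; exact: (Mc _ _ Mx Ma xi).
split=> //; have [y My ay] := vna_adjoint Mv Ma.
suff -> : J \o a \o J = y by [].
apply/funext => xi; apply/eqP; rewrite -subr_eq0; apply: contraT => n0.
have := @neq0_dnorm_gt0 _ _ _ (hdot H) _ n0.
by rewrite dotBr -ay -adj subrr ltxx.
Qed.

Section ComplexSpace.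
Variable R : realType.

Lemma real_cauchy_seq (u : nat -> R) :
  (forall e : R, 0 < e -> exists N, forall m n, (N <= m)%N -> (N <= n)%N -> `|u m - u n| <= e) ->
  exists l : R, forall e : R, 0 < e -> exists N, forall n, (N <= n)%N -> `|u n - l| <= e.
Proof.
move=> uC.
have : cauchy (u @ \oo).
  apply: cauchy_exP => e e0; have e20 : 0 < e / 2 by rewrite divr_gt0.
  have [N hN] := uC _ e20; exists (u N); exists N => // n /= Nn.
  rewrite -ball_normE /=; apply: le_lt_trans (hN _ _ (leqnn N) Nn) _.
  by rewrite ltr_pdivrMr // ltr_pMr // ltr1n.
move=> /cauchy_cvg /cvg_ex[l /cvgrPdist_le ul]; exists l => e e0.
have [N _ hN] := ul e e0; exists N => n Nn.
by rewrite distrC; exact: hN.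
Qed.

Lemma complex_cauchy_seq (u : nat -> R[i]) :
  (forall e : R[i], 0 < e -> exists N, forall m n, (N <= m)%N -> (N <= n)%N -> `|u m - u n| <= e) ->
  exists l : R[i], forall e : R[i], 0 < e -> exists N, forall n, (N <= n)%N -> `|u n - l| <= e.
Proof.
move=> uC.
have uC' (e : R) : 0 < e -> exists N, forall m n, (N <= m)%N -> (N <= n)%N ->
    `|u m - u n| <= e%:C%C by move=> e0; apply: uC; rewrite ltcR.
have [a ha] : exists l : R, forall e : R, 0 < e ->
    exists N, forall n, (N <= n)%N -> `|complex.Re (u n) - l| <= e.
  apply: real_cauchy_seq => e /uC'[N hN]; exists N => m n Nm Nn.
  by rewrite -ReB -lecR (le_trans (normc_ge_Re _)) // hN.
have [b hb] : exists l : R, forall e : R, 0 < e ->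
    exists N, forall n, (N <= n)%N -> `|complex.Im (u n) - l| <= e.
  apply: real_cauchy_seq => e /uC'[N hN]; exists N => m n Nm Nn.
  by rewrite -raddfB -lecR (le_trans (normc_Im _)) // hN.
exists (a +i* b)%C => e e0.
have er := ge0_ReK (ltW e0).
have r0 : 0 < complex.Re e / 2 by rewrite divr_gt0 //; move: e0; rewrite -{1}er ltcR.
have [N1 h1] := ha _ r0; have [N2 h2] := hb _ r0; exists (maxn N1 N2) => n.
rewrite geq_max => /andP[/h1 {}h1 /h2 {}h2].
apply: le_trans (normc_Re_Im _) _; rewrite -er lecR [leRHS]splitr.
by apply: lerD; [move: h1|move: h2]; case: (u n).
Qed.

Variable n : nat.
Local Notation V := 'rV[R[i]]_n.

Lemma dotmx_sum (u v : V) : dotmx u v = \sum_i u 0 i * (v 0 i)^*.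
Proof. by rewrite dotmxE mxE; apply: eq_bigr => i _; rewrite !mxE. Qed.

Lemma norm_sq_entrys (u : dot_space (@dotmx R[i] n)) :
  `|u| ^+ 2 = \sum_i `|(u : V) 0 i| ^+ 2.
Proof.
transitivity (dotmx (u : V) (u : V)); first exact: sqrtCK.
by rewrite dotmx_sum; apply: eq_bigr => i _; rewrite normCK.
Qed.

Lemma entry_le_norm (u : dot_space (@dotmx R[i] n)) i : `|(u : V) 0 i| <= `|u|.
Proof.
rewrite -(ler_pXn2r (n := 2)) ?nnegrE // norm_sq_entrys (bigD1 i) //= lerDl.
by apply: sumr_ge0 => k _; rewrite exprn_ge0.
Qed.

Lemma norm_delta i : `|(delta_mx 0 i : V) : dot_space (@dotmx R[i] n)| = 1.
Proof.
apply/eqP; rewrite -(eqrXn2 (n := 2)) //; apply/eqP.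
rewrite norm_sq_entrys (bigD1 i) //= big1 => [|k ki].
  by rewrite !mxE !eqxx normr1 addr0.
by rewrite !mxE (negPf ki) andbF normr0 expr0n.
Qed.

Lemma norm_le_entrys (u : dot_space (@dotmx R[i] n)) : `|u| <= \sum_i `|(u : V) 0 i|.
Proof.
have -> : `|u| = `|\sum_i ((u : V) 0 i *: delta_mx 0 i : dot_space (@dotmx R[i] n))|.
  by congr `|_|; exact: row_sum_delta.
apply: le_trans (ler_norm_sum _ _ _) _; apply: ler_sum => i _.
by rewrite normrZ norm_delta mulr1.
Qed.

Lemma complex_space_complete : seq_complete (dot_space (@dotmx R[i] n)).
Proof.
move=> u uC.
have [l hl] : {l : 'I_n -> R[i] & forall i (e : R[i]), 0 < e ->
    exists N, forall k, (N <= k)%N -> `|(u k : V) 0 i - l i| <= e}.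
  apply: (@choice _ _ (fun i l => forall e : R[i], 0 < e ->
    exists N, forall k, (N <= k)%N -> `|(u k : V) 0 i - l| <= e)) => i.
  apply: complex_cauchy_seq => e /uC[N hN]; exists N => m k Nm Nk.
  by have := entry_le_norm (u m - u k) i; rewrite !mxE => /le_trans; apply; exact: hN.
exists (\row_i l i) => e e0.
have e1 : 0 < e / n.+1%:R by rewrite divr_gt0.
have [N hN] : {N : 'I_n -> nat & forall i k, (N i <= k)%N -> `|(u k : V) 0 i - l i| <= e / n.+1%:R}.
  apply: (@choice _ _ (fun i N => forall k, (N <= k)%N ->
    `|(u k : V) 0 i - l i| <= e / n.+1%:R)) => i; exact: hl.
exists (\max_i N i) => k Nk; apply: le_trans (norm_le_entrys _) _.
apply: le_trans (_ : \sum_(i < n) e / n.+1%:R <= _).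
  apply: ler_sum => i _; rewrite !mxE; apply: hN; apply: leq_trans Nk.
  exact: leq_bigmax.
rewrite sumr_const card_ord -[leLHS]mulr_natr -mulrA ler_piMr ?(ltW e0) //.
by rewrite mulrC ler_pdivrMr // mul1r ler_nat.
Qed.

Definition complex_space : hilbert R := hilbert_of_dot complex_space_complete.
Local Notation H := complex_space.
Implicit Types (xi eta : H).

Definition entry xi i : R[i] := (xi : V) 0 i.
Definition basis_vec i : H := (delta_mx 0 i : V).
Definition diag_op (a : 'I_n -> R[i]) xi : H := (\row_i (a i * entry xi i) : V).
Definition conj_vec xi : H := (\row_i (entry xi i)^* : V).
Definition diag_alg : set (H -> H) := range diag_op.
Definition pos_cone : set H := [set xi | forall i, 0 <= entry xi i].

Lemma entryP xi eta : (forall i, entry xi i = entry eta i) -> xi = eta.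
Proof. by move=> h; apply/rowP => i; exact: h. Qed.

Lemma entry_diag a xi i : entry (diag_op a xi) i = a i * entry xi i.
Proof. by rewrite /entry mxE. Qed.

Lemma entry_conj xi i : entry (conj_vec xi) i = (entry xi i)^*.
Proof. by rewrite /entry mxE. Qed.

Lemma entry_basis i k : entry (basis_vec i) k = (k == i)%:R.
Proof. by rewrite /entry mxE eqxx. Qed.

Lemma entryD (c : R[i]) xi eta i : entry (c *: xi + eta) i = c * entry xi i + entry eta i.
Proof. by rewrite /entry !mxE. Qed.

Lemma entryB xi eta i : entry (xi - eta) i = entry xi i - entry eta i.
Proof. by rewrite /entry !mxE. Qed.

Lemma dot_entry xi eta : '[xi, eta] = \sum_i entry xi i * (entry eta i)^*.
Proof. exact: dotmx_sum. Qed.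

Lemma dot_basis xi i : '[xi, basis_vec i] = entry xi i.
Proof.
rewrite dot_entry (bigD1 i) //= big1 => [|k ki].
  by rewrite entry_basis eqxx rmorph1 mulr1 addr0.
by rewrite entry_basis (negPf ki) rmorph0 mulr0.
Qed.

Lemma sum_basis xi : xi = \sum_i entry xi i *: basis_vec i.
Proof. exact: row_sum_delta. Qed.

Lemma norm_basis i : `|basis_vec i| = 1.
Proof. exact: norm_delta. Qed.

Lemma diag_basis a i : diag_op a (basis_vec i) = a i *: basis_vec i.
Proof.
apply: entryP => k; rewrite entry_diag entry_basis.
have -> : entry (a i *: basis_vec i) k = a i * entry (basis_vec i) k by rewrite /entry !mxE.
by rewrite entry_basis; case: eqP => [->//|_]; rewrite !mulr0.
Qed.

Lemma diag_linear a : linear (diag_op a).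
Proof. by move=> c xi eta; apply: entryP => i; rewrite !(entry_diag, entryD); ring. Qed.

Lemma diag_bounded a : bounded_op (diag_op a).
Proof.
split; first exact: diag_linear.
pose B := \sum_i complex.Re `|a i|.
have B0 : 0 <= B by apply: sumr_ge0 => i _; exact: (Re_ge0 (normr_ge0 (a i))).
have aB i : `|a i| <= B%:C%C.
  rewrite -(ge0_ReK (normr_ge0 (a i))) lecR /B (bigD1 i) //= lerDl.
  by apply: sumr_ge0 => k _; exact: (Re_ge0 (normr_ge0 (a k))).
exists B => xi; rewrite -(ler_pXn2r (n := 2)) ?nnegrE ?mulr_ge0 ?lecR //.
rewrite exprMn !hnormE !dot_entry mulr_sumr; apply: ler_sum => i _.
rewrite entry_diag -!normCK normrM exprMn; apply: ler_wpM2r; first exact: exprn_ge0.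
by rewrite ler_pXn2r ?nnegrE //; exact: le_trans (aB i).
Qed.

(** A linear map preserving the coordinate lines is diagonal. This description
    passes to strong limits and characterizes the commutant. *)
Lemma linear_diag x : linear x -> (forall i k, k != i -> entry (x (basis_vec i)) k = 0) ->
  diag_alg x.
Proof.
move=> xl x0; exists (fun i => entry (x (basis_vec i)) i) => //.
apply/funext => xi; rewrite [in RHS](sum_basis xi).
have sumx (s : seq 'I_n) (f : 'I_n -> H) : x (\sum_(i <- s) f i) = \sum_(i <- s) x (f i).
  elim: s => [|i s ih]; first by rewrite !big_nil lin0.
  by rewrite !big_cons (linD xl) ih.
rewrite sumx [LHS]sum_basis; apply: eq_bigr => i _.
rewrite (linZ xl) entry_diag mulrC -scalerA; congr (_ *: _); apply: entryP => k.
have -> : entry (entry (x (basis_vec i)) i *: basis_vec i) k =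
  entry (x (basis_vec i)) i * entry (basis_vec i) k by rewrite /entry !mxE.
by rewrite entry_basis; case: eqP => [->|/eqP/x0 ->]; rewrite ?mulr1 ?mulr0.
Qed.

Lemma diag_adjoint a : is_adjoint (diag_op a) (diag_op (fun i => (a i)^*)).
Proof.
move=> xi eta; rewrite !dot_entry; apply: eq_bigr => i _.
by rewrite !entry_diag rmorphM /= conjCK; ring.
Qed.

Lemma diag_commutative x y : diag_alg x -> diag_alg y -> forall xi, x (y xi) = y (x xi).
Proof.
by move=> [a _ <-] [b _ <-] xi; apply: entryP => i; rewrite !entry_diag mulrCA.
Qed.

Lemma diag_vna : von_neumann_algebra diag_alg.
Proof.
split.
- by move=> _ [a _ <-]; exact: diag_bounded.
- by exists (fun=> 1) => //; apply/funext => xi; apply: entryP => i; rewrite entry_diag mul1r.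
- move=> c _ _ [a _ <-] [b _ <-]; exists (fun i => c * a i + b i) => //.
  by apply/funext => xi; apply: entryP => i; rewrite entryD !entry_diag; ring.
- move=> _ _ [a _ <-] [b _ <-]; exists (fun i => a i * b i) => //.
  by apply/funext => xi; apply: entryP => i; rewrite /= !entry_diag mulrA.
- move=> _ [a _ <-]; exists (diag_op (fun i => (a i)^*)); last exact: diag_adjoint.
  by exists (fun i => (a i)^*).
- move=> x xA; have [xl _] := xA.1; apply: linear_diag => // i k ki.
  apply: approx_eq0 => e e0.
  have [_ [a _ <-] h] := sot_approx [:: basis_vec i] xA e0.
  have := entry_le_norm (x (basis_vec i) - diag_op a (basis_vec i)) k.
  rewrite [X in `|X|](entryB _ _ k) entry_diag entry_basis (negPf ki) mulr0 subr0.
  by move=> /le_trans; apply; rewrite ltW // h // mem_head.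
Qed.

Lemma diag_conj a : conj_vec \o diag_op a \o conj_vec = diag_op (fun i => (a i)^*).
Proof.
apply/funext => xi; apply: entryP => i.
by rewrite /= entry_conj !entry_diag entry_conj rmorphM /= conjCK.
Qed.

Lemma diag_standard_form : standard_form diag_alg conj_vec pos_cone.
Proof.
have conjK : involutive conj_vec.
  by move=> xi; apply: entryP => i; rewrite !entry_conj conjCK.
split=> //.
- exact: diag_vna.
- move=> c xi eta; apply: entryP => i.
  by rewrite entryD !entry_conj entryD rmorphD rmorphM.
- move=> xi; apply/eqP; rewrite -(eqrXn2 (n := 2)) //; apply/eqP.
  rewrite !hnormE !dot_entry; apply: eq_bigr => i _.
  by rewrite entry_conj conjCK mulrC.
- apply/seteqP; split=> xi /= h.
    by move=> eta he; rewrite dot_entry sumr_ge0 // => i _; rewrite mulr_ge0 // conjC_ge0.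
  move=> i; rewrite -dot_basis; apply: h => k; rewrite entry_basis; exact: ler0n.
- apply/seteqP; split.
    move=> _ [_ [a _ <-] <-]; rewrite diag_conj; split; first exact: diag_bounded.
    by move=> x xA xi /=; apply: diag_commutative => //; exists (fun i => (a i)^*).
  move=> y [[yl _] yc].
  have [a _ <-] : diag_alg y.
    apply: linear_diag => // i k ki.
    have := yc (diag_op (fun k => (k == i)%:R)) (ex_intro2 _ _ _ I erefl) (basis_vec i).
    rewrite /= diag_basis eqxx scale1r => <-.
    by rewrite entry_diag (negPf ki) mul0r.
  exists (diag_op (fun i => (a i)^*)); first by exists (fun i => (a i)^*).
  by rewrite diag_conj; congr diag_op; apply/funext => i; rewrite conjCK.
- by move=> _ [a _ <-] _; rewrite diag_conj; exact: diag_adjoint.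
- by move=> xi xi0; apply: entryP => i; rewrite entry_conj geC0_conj.
- move=> _ xi [a _ <-] xi0 i; rewrite entry_diag entry_conj entry_diag entry_conj.
  by rewrite rmorphM /= conjCK mulrA -normCK mulr_ge0 ?exprn_ge0.
Qed.

End ComplexSpace.

(** * Rank one projections in an abelian algebra *)

Section UltraLimitFacts.
Variables (R : realType) (w : free_ultrafilter).
Implicit Types (u : nat -> R[i]).

Lemma ulim_near u (l : R[i]) : fu_sets w [set j | u j = l] -> ulim w u = l.
Proof.
move=> ul; apply: ulimP; apply/cvgrPdist_le => e e0; apply: filterS ul => j /= ->.
by rewrite subrr normr0 ltW.
Qed.

Lemma ulim_Re_le u (C : R) : bounded_scal u ->
  fu_sets w [set j | complex.Re (u j) <= C] -> complex.Re (ulim w u) <= C.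
Proof.
move=> ub uC; rewrite leNgt; apply/negP => hC.
have d0 : 0 < (complex.Re (ulim w u) - C)%:C%C by rewrite ltcR subr_gt0.
have /cvgrPdist_lt/(_ _ d0) near_u := @bounded_ultra_cvg R w u ub.
have [j [/= h1 h2]] := filter_ex (filterI uC near_u).
have := le_lt_trans (normc_ge_Re _) h2; rewrite ltcR ReB.
by move=> /(le_lt_trans (ler_norm _)); lra.
Qed.

End UltraLimitFacts.

Section WeightFacts.
Variables (R : realType) (H : hilbert R) (M : set (H -> H)).
Hypothesis Mv : von_neumann_algebra M.

Lemma weight_le (phi : (H -> H) -> \bar R) x y : weight M phi ->
  pos_part M x -> pos_part M y -> op_le x y -> (phi x <= phi y)%E.
Proof.
move=> phiw xM yM xy.
have dM : pos_part M (fun xi => y xi - x xi).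
  split=> [|xi]; last by rewrite dotBl subr_ge0.
  have := vna_linear Mv (-1) xM.1 yM.1; congr M.
  by apply/funext => xi; rewrite scaleN1r addrC.
have -> : y = (fun xi => x xi + (y xi - x xi)).
  by apply/funext => xi; rewrite addrC subrK.
by rewrite (weightD phiw) // leeDl // (weight_ge0 phiw).
Qed.

Lemma pos_partZ (a : R) x : 0 <= a -> pos_part M x -> pos_part M (fun xi => a%:C%C *: x xi).
Proof.
move=> a0 [Mx xp]; split=> [|xi]; first exact: vnaZ.
by rewrite dotZl mulr_ge0 // lecR.
Qed.

End WeightFacts.

Section RankOne.
Variables (R : realType) (H : hilbert R) (M : set (H -> H)).
Hypothesis Mv : von_neumann_algebra M.
Hypothesis Mc : forall x y, M x -> M y -> forall xi, x (y xi) = y (x xi).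

Definition rank_one (v : H) (k : H) : H := '[k, v] *: v.

Variable v : H.
Hypothesis v1 : '[v, v] = 1.
Hypothesis Me : M (rank_one v).

Lemma rank_one_fix : rank_one v v = v.
Proof. by rewrite /rank_one v1 scale1r. Qed.

Lemma rank_one_projection : projection M (rank_one v).
Proof.
split=> // [xi eta|xi]; last by rewrite /rank_one dotZl v1 mulr1.
by rewrite /rank_one dotZl dotZr mulrC [X in X * _]dot_conj.
Qed.

Lemma rank_one_form (k : H) : '[rank_one v k, k] = `|'[k, v]| ^+ 2.
Proof. by rewrite /rank_one dotZl [X in _ * X]dot_conj normCK. Qed.

(** Since x commutes with the projection onto the line of v, it preserves that
    line. *)
Lemma rank_one_minimal x k : M x -> x (rank_one v k) = '[x v, v] *: rank_one v k.
Proof.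
move=> Mx; rewrite /rank_one (linZ (vna_lin Mv Mx)) scalerA mulrC -scalerA.
by congr (_ *: _); rewrite -[LHS](congr1 x rank_one_fix) (Mc Mx Me).
Qed.

(** By semifiniteness some y of finite square weight has mu = <y v, v> nonzero,
    and |mu|^2 times the projection lies below y^* y. *)
Lemma nsf_rank_one_finite phi : nsf_weight M phi -> (phi (rank_one v) < +oo)%E.
Proof.
move=> [phiw _ phisf _].
have vf := vector_functional Mv v.
have [y [My [y' [My' yy' yfin]]] /(_ ord0)] :=
  phisf id (vna_id Mv) 1 (fun=> (fun x => '[x v, v])) (fun=> vf) 1 ltr01.
rewrite v1; set mu := '[y v, v] => hmu.
have mu0 : mu != 0.
  by apply/eqP => e0; move: hmu; rewrite e0 subr0 normr1 ltxx.
pose a := complex.Re (`|mu| ^+ 2).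
have aE : a%:C%C = `|mu| ^+ 2 by rewrite ge0_ReK ?exprn_ge0.
have a0 : 0 < a by rewrite -ltcR aE exprn_gt0 // normr_gt0.
have eM := projection_pos rank_one_projection.
have yyM : pos_part M (y' \o y).
  split=> [|xi]; first exact: vna_comp.
  by rewrite /= (adjoint_sym yy') dnorm_ge0.
have le : op_le (fun xi => a%:C%C *: rank_one v xi) (y' \o y).
  move=> k; rewrite dotZl aE rank_one_form /= (adjoint_sym yy').
  have <- : `|'[y k, v]| ^+ 2 = `|mu| ^+ 2 * `|'[k, v]| ^+ 2.
    rewrite -exprMn -normrM; congr (`|_| ^+ 2).
    have := rank_one_minimal k My; rewrite (Mc My Me) -/mu /rank_one scalerA.
    by move=> /(congr1 (fun u => '[u, v])); rewrite !dotZl v1 !mulr1.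
  by rewrite -rank_one_form; exact: (projection_le1 Mv rank_one_projection).
have := weight_le Mv phiw (pos_partZ Mv (ltW a0) eM) yyM le.
rewrite (weightZ phiw) ?(ltW a0) // => h.
have := le_lt_trans h yfin; have := weight_ge0 phiw eM.
case: (phi _) => [r _ _|_|//]; first by rewrite ltry.
by rewrite mulry gtr0_sg // mul1e.
Qed.

(** The difference is the compression of x to the orthogonal complement of v. *)
Lemma rank_one_below x : pos_part M x ->
  op_le (fun k => (complex.Re '[x v, v])%:C%C *: rank_one v k) x.
Proof.
move=> [Mx xp] k; rewrite (ge0_ReK (xp v)) -rank_one_minimal // -subr_ge0.
have [_ es ei] := rank_one_projection.
have -> : '[x k, k] - '[x (rank_one v k), k] =
    '[x (k - rank_one v k), k - rank_one v k].
  rewrite (linB (vna_lin Mv Mx)) dotBl !dotBr -![in '[_, rank_one v k]]es.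
  by rewrite -!(Mc Mx Me) ei subrr subr0.
exact: xp.
Qed.

(** The largest weight with value C at the projection onto v: it is finite only
    on the multiples of that projection. Comparing with it bounds the value of an
    ultraproduct weight at the projection from above, using that the ultraproduct
    weight is the least one. *)
Definition corner_weight (C : R) (x : H -> H) : \bar R :=
  if `[< forall k, x k = x (rank_one v k) >] then (C * complex.Re '[x v, v])%:E
  else +oo%E.

Lemma corner_weightP (C : R) : 0 <= C -> weight M (corner_weight C).
Proof.
move=> C0.
have ge0 x : pos_part M x -> (0 <= corner_weight C x)%E.
  move=> [_ xp]; rewrite /corner_weight; case: asboolP => _; rewrite ?lee_fin ?leey //.
  by rewrite mulr_ge0 // Re_ge0.
split=> // [x y xM yM|a x a0 xM].
  have [xl yl] := (pos_part_linear Mv xM, pos_part_linear Mv yM).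
  rewrite /corner_weight; case: asboolP => [xy|nxy]; last first.
    case: asboolP => [hx|_]; last first.
      by rewrite addye //; case: asboolP => _; rewrite ?ltNye.
    case: asboolP => [hy|_]; last by rewrite addey.
    by case: nxy => k; rewrite hx hy.
  have z0 k : x (k - rank_one v k) = 0 /\ y (k - rank_one v k) = 0.
    set u := k - rank_one v k.
    have s0 : '[x u, u] + '[y u, u] = 0.
      rewrite -dotDl (linB xl) (linB yl) addrACA -opprD xy subrr.
      by rewrite dot0l.
    have [hx hy] : '[x u, u] = 0 /\ '[y u, u] = 0.
      move/eqP: s0; rewrite paddr_eq0; [|exact: xM.2|exact: yM.2].
      by move=> /andP[/eqP ? /eqP].
    by split; apply: positive_form0 => //; [exact: xM.2|exact: yM.2].
  have hx k : x k = x (rank_one v k).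
    by apply/eqP; rewrite -subr_eq0 -(linB xl) (z0 k).1.
  have hy k : y k = y (rank_one v k).
    by apply/eqP; rewrite -subr_eq0 -(linB yl) (z0 k).2.
  rewrite asboolT // asboolT // -EFinD dotDl ReD mulrDr.
  by [].
have aC : a%:C%C != 0 -> (forall k, a%:C%C *: x k = a%:C%C *: x (rank_one v k)) ->
    forall k, x k = x (rank_one v k).
  by move=> an h k; apply: (scalerI an); exact: h.
rewrite /corner_weight dotZl ReZ mulrCA EFinM.
move: a0; rewrite le_eqVlt => /predU1P[<-|a0].
  by rewrite !mul0e asboolT // => k; rewrite !scale0r.
have an : a%:C%C != 0 by rewrite gt_eqF // ltcR.
case: asboolP => [h|nh]; first by rewrite asboolT //; exact: aC.
rewrite asboolF; first by rewrite mulry gtr0_sg // mul1e.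
by move=> h; apply: nh => k; rewrite h.
Qed.

End RankOne.

(** * Atoms of the ultraproduct of the diagonal algebras *)

Section Atoms.
Variables (R : realType) (w : free_ultrafilter).

Definition dspace (j : nat) : hilbert R := complex_space R j.+1.
Definition dalg (j : nat) : set (dspace j -> dspace j) := @diag_alg R j.+1.
Arguments dalg : clear implicits.
Local Notation K := (hilbert_ultraproduct w dspace).
Local Notation M := (groh_raynaud w dalg).

Definition line_proj n (i : 'I_n) : complex_space R n -> complex_space R n :=
  diag_op (fun k => (k == i)%:R).

Lemma line_projE n (i : 'I_n) xi : line_proj i xi = entry xi i *: basis_vec R i.
Proof.
apply: entryP => k; rewrite entry_diag.
have -> : entry (entry xi i *: basis_vec R i) k = entry xi i * entry (basis_vec R i) k.
  by rewrite /entry !mxE.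
by rewrite entry_basis; case: eqP => [->|_]; rewrite ?mul1r ?mulr1 ?mul0r ?mulr0.
Qed.

Lemma line_proj_in n (i : 'I_n) : diag_alg (@line_proj n i).
Proof. by exists (fun k => (k == i)%:R). Qed.

Lemma line_proj_norm n (i : 'I_n) : op_norm_le (@line_proj n i) 1.
Proof.
move=> xi; rewrite line_projE normrZ norm_basis mulr1 mul1r.
exact: (entry_le_norm xi i).
Qed.

Lemma line_proj_pos n (i : 'I_n) : pos_part (@diag_alg R n) (@line_proj n i).
Proof.
split=> [|xi]; first exact: line_proj_in.
rewrite line_projE dotZl dot_conj dot_basis -normCK exprn_ge0 //.
Qed.

Lemma dalg_vna j : von_neumann_algebra (dalg j).
Proof. exact: diag_vna. Qed.

Lemma dalg_conj j (a : dspace j -> dspace j) : dalg j a ->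
  dalg j (@conj_vec R j.+1 \o a \o @conj_vec R j.+1) /\
  is_adjoint a (@conj_vec R j.+1 \o a \o @conj_vec R j.+1).
Proof. exact: standard_form_conj (diag_standard_form R j.+1) (@diag_commutative R j.+1) _. Qed.

Lemma ultra_vna : von_neumann_algebra M.
Proof.
apply: (@groh_raynaud_vna R w dspace dalg (fun j => @conj_vec R j.+1)).
- by move=> j; exact: diag_vna.
- by move=> j; exact: (sf_antilinear (diag_standard_form R j.+1)).
- by move=> j; exact: (sf_isometry (diag_standard_form R j.+1)).
- exact: dalg_conj.
Qed.

Lemma ultra_commutative x y : M x -> M y -> forall xi, x (y xi) = y (x xi).
Proof.
apply: groh_raynaud_commutative; first by move=> j; exact: diag_vna.
by move=> j a b; exact: diag_commutative.
Qed.

Variable i : forall j, 'I_j.+1.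

Definition atom_vec : K := ultra_vec w (fun j => basis_vec R (i j) : dspace j).
Definition atom_seq (j : nat) : dspace j -> dspace j := line_proj (i j).
Definition atom : K -> K := ultra_op atom_seq.

Lemma bounded_seq_basis (c : nat -> R[i]) : bounded_scal c ->
  bounded_seq (fun j => c j *: basis_vec R (i j) : dspace j).
Proof. by move=> [B cB]; exists B => j; rewrite normrZ norm_basis mulr1. Qed.

Lemma bounded_seq_basis1 : bounded_seq (fun j => basis_vec R (i j) : dspace j).
Proof. by exists 1 => j; rewrite norm_basis. Qed.

Lemma atom_seqP : bounded_op_seq dalg atom_seq.
Proof.
split=> [j|]; first exact: line_proj_in.
by exists 1 => j; exact: line_proj_norm.
Qed.

Lemma ultra_vec_basis (c : nat -> R[i]) : bounded_scal c ->
  ultra_vec w (fun j => c j *: basis_vec R (i j) : dspace j) = ulim w c *: atom_vec.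
Proof.
move=> cb; have bb := bounded_seq_basis cb; have b1 := bounded_seq_basis1.
apply/eqP; rewrite -subr_eq0 -normr_eq0; apply/eqP.
have -> : ultra_vec w (fun j => c j *: basis_vec R (i j) : dspace j) - ulim w c *: atom_vec =
    ultra_vec w (fun j => (c j - ulim w c) *: basis_vec R (i j) : dspace j).
  have := ultra_vec_comb w (- ulim w c) b1 bb; rewrite -/atom_vec scaleNr addrC => <-.
  congr (ultra_vec w _); apply: functional_extensionality_dep => j.
  by rewrite addrC scalerBl scaleNr.
rewrite ultra_vec_norm; last first.
  apply: bounded_seq_basis; have [B cB] := cb.
  exists (B + complex.Re `|ulim w c|) => j.
  by rewrite rcD (ge0_ReK (normr_ge0 _)) (le_trans (ler_normB _ _)) // lerD.
have := @bounded_ultra_cvg R w c cb => /cvgrPdist_le hc.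
apply: ulimP; apply/cvgrPdist_le => e e0; apply: filterS (hc e e0) => j /=.
by rewrite sub0r normrN normr_id normrZ norm_basis mulr1 distrC.
Qed.

Lemma bounded_entry (eta : forall j, dspace j) : bounded_seq eta ->
  bounded_scal (fun j => entry (eta j) (i j)).
Proof.
move=> [B eB]; exists B => j; apply: le_trans (eB j).
exact: (entry_le_norm (eta j) (i j)).
Qed.

(** Along the ultrafilter only the ultralimit of the coordinate of index i j
    is left, so the sequence of minimal projections acts by a rank one
    projection. *)
Lemma atomE : atom = rank_one atom_vec.
Proof.
apply/funext; elim/ultra_vec_ind => eta be; rewrite /rank_one.
rewrite /atom (ultra_op_vec w dalg_vna atom_seqP be).
rewrite (ultra_vec_dot w be bounded_seq_basis1) /atom_seq.
transitivity (ultra_vec w (fun j => entry (eta j) (i j) *: basis_vec R (i j) : dspace j)).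
  congr (ultra_vec w _); apply: functional_extensionality_dep => j.
  exact: line_projE.
rewrite ultra_vec_basis; last exact: bounded_entry.
by congr (ulim w _ *: _); apply/funext => j; rewrite dot_basis.
Qed.

Lemma atom_vec1 : '[atom_vec, atom_vec] = 1.
Proof.
rewrite (ultra_vec_dot w bounded_seq_basis1 bounded_seq_basis1); apply: ulim_near.
by apply: filterE => j /=; rewrite dot_basis entry_basis eqxx.
Qed.

Lemma atom_fix : atom atom_vec = atom_vec.
Proof. by rewrite atomE; exact: rank_one_fix atom_vec1. Qed.

Lemma atom_in : M atom.
Proof.
apply: ultra_op_groh_raynaud; last exact: atom_seqP.
by move=> j; exact: diag_vna.
Qed.

Lemma atom_projection : projection M atom.
Proof.
by rewrite atomE; apply: rank_one_projection; rewrite ?atom_vec1 // -atomE; exact: atom_in.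
Qed.

End Atoms.
Arguments atom : clear implicits.
Arguments dalg : clear implicits.

(** * Weights of atoms and the unbounded weight *)

Section WeightsOfAtoms.
Variables (R : realType) (w : free_ultrafilter).
Local Notation K := (hilbert_ultraproduct w (dspace R)).
Local Notation M := (groh_raynaud w (dalg R)).
Local Notation index := (forall j, 'I_j.+1).
Variable phi_ : forall j, (dspace R j -> dspace R j) -> \bar R.
Arguments phi_ : clear implicits.
Variable phi : (K -> K) -> \bar R.
Hypothesis phi_weight : forall j, weight (dalg R j) (phi_ j).
Hypothesis phi_ultra : is_ultraproduct_weight w (dalg R) phi_ phi.

Lemma line_proj_rank_one n (k : 'I_n) : @line_proj R n k = rank_one (basis_vec R k).
Proof. by apply/funext => xi; rewrite line_projE /rank_one dot_basis. Qed.

Lemma dot_basis1 n (k : 'I_n) : '[basis_vec R k, basis_vec R k] = 1.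
Proof. by rewrite dot_basis entry_basis eqxx. Qed.

(** A positive diagonal operator dominates its own restriction to a line. *)
Lemma weight_line_le j (k : 'I_j.+1) x : pos_part (dalg R j) x ->
  ((complex.Re '[x (basis_vec R k : dspace R j), basis_vec R k])%:E *
     phi_ j (line_proj k) <= phi_ j x)%E.
Proof.
move=> xM; have Mv := @dalg_vna R j.
have t0 := Re_ge0 (xM.2 (basis_vec R k)).
have eM : pos_part (dalg R j) (line_proj k) := line_proj_pos R k.
have Me : dalg R j (rank_one (basis_vec R k : dspace R j)).
  by rewrite -line_proj_rank_one; exact: line_proj_in.
have := rank_one_below Mv (@diag_commutative R j.+1) (dot_basis1 k) Me xM.
rewrite -line_proj_rank_one => le.
have := weight_le Mv (phi_weight j) (pos_partZ Mv t0 eM) xM le.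
by rewrite (weightZ (phi_weight j) t0 eM).
Qed.

(** Where phi_ j is at least C on the chosen line, C times the vector functional
    of its unit vector is a minorant; the ultraproduct of these functionals is
    again a vector functional, and takes the value C at the atom. *)
Lemma weight_atom_ge (i : index) (C : R) : 0 <= C ->
  fu_sets w [set j | (C%:E <= phi_ j (line_proj (i j)))%E] ->
  (C%:E <= phi (atom R w i))%E.
Proof.
move=> C0 wC.
(* The square root turns C times a vector functional into the functional of one
   vector; the zero value off the given set of indices keeps r bounded. *)
pose r j : R := if `[< (C%:E <= phi_ j (line_proj (i j)))%E >] then Num.sqrt C else 0.
pose v j : dspace R j := (r j)%:C%C *: basis_vec R (i j).
have r0 j : 0 <= r j by rewrite /r; case: asboolP; rewrite ?sqrtr_ge0.
have rC j : r j <= Num.sqrt C by rewrite /r; case: asboolP; rewrite ?sqrtr_ge0.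
have rb : bounded_scal (fun j => (r j)%:C%C).
  by exists (Num.sqrt C) => j; rewrite ger0_norm ?lecR.
have vb : bounded_seq v := bounded_seq_basis i rb.
have vE : ultra_vec w v = (Num.sqrt C)%:C%C *: atom_vec R w i.
  rewrite /v ultra_vec_basis //; congr (_ *: _); apply: ulim_near.
  by apply: filterS wC => j /= hj; rewrite /r asboolT.
have vform j x : dalg R j x -> '[x (v j), v j] =
    (r j ^+ 2)%:C%C * '[x (basis_vec R (i j) : dspace R j), basis_vec R (i j)].
  move=> Mx; rewrite /v (linZ (vna_lin (@dalg_vna R j) Mx)) dotZl dotZr.
  rewrite mulrA; congr (_ * _); rewrite geC0_conj ?lecR //.
  by rewrite -rcM expr2.
have vnorm j : `|v j| = (r j)%:C%C by rewrite normrZ norm_basis mulr1 ger0_norm ?lecR.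
pose rho_ j (x : dspace R j -> dspace R j) := '[x (v j), v j].
pose rho (x : K -> K) := '[x (ultra_vec w v), ultra_vec w v].
have minor : ultra_minorant (dalg R) phi_ rho.
  exists rho_; split.
  - by move=> j; exact: vector_functional (@dalg_vna R j) (v j).
  - move=> j x xM; rewrite /rho_ (vform _ _ xM.1) ReZ /r.
    case: asboolP => [hC|_]; last first.
      by rewrite expr0n /= mul0r; exact: (weight_ge0 (phi_weight j) xM).
    rewrite sqr_sqrtr // mulrC; apply: le_trans (weight_line_le (i j) xM).
    by rewrite EFinM lee_wpmul2l // lee_fin; exact: Re_ge0 (xM.2 _).
  - exists C => j x Mx x1; apply: le_trans (hilbert_cauchy_schwarz _ _) _.
    apply: le_trans (_ : `|v j| * `|v j| <= _).
      apply: ler_wpM2r; first exact: normr_ge0.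
      by have := x1 (v j); rewrite mul1r.
    by rewrite vnorm -rcM lecR -[leRHS]sqr_sqrtr // expr2 ler_pM.
  - split; first exact: vector_functional (ultra_vna R w) _.
    move=> x xP; rewrite /rho (ultra_op_vec w (@dalg_vna R) xP vb).
    exact: (ultra_vec_dot w (bounded_seq_op (@dalg_vna R) xP vb) vb).
have eM := projection_pos (atom_projection R w i).
have := upw_majorizes phi_ultra minor eM.
rewrite /rho vE atomE (rank_one_form (atom_vec R w i)).
rewrite dotZl atom_vec1 mulr1 ger0_norm ?lecR ?sqrtr_ge0 //.
by rewrite -rmorphXn sqr_sqrtr.
Qed.

(** Each minorant takes at the atom an ultralimit of values at most C, hence is
    majorized by the corner weight with constant C. *)
Lemma weight_atom_le (i : index) (C : R) : 0 <= C ->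
  fu_sets w [set j | (phi_ j (line_proj (i j)) <= C%:E)%E] ->
  (phi (atom R w i) <= C%:E)%E.
Proof.
move=> C0 wC.
have Mv := ultra_vna R w; have Mc := @ultra_commutative R w.
have v1 := atom_vec1 R w i.
have Me : M (rank_one (atom_vec R w i)) by rewrite -atomE; exact: atom_in.
pose psi := corner_weight (atom_vec R w i) C.
have psiw : weight M psi by exact: corner_weightP.
have eM := projection_pos (atom_projection R w i).
have maj : majorizes (dalg R) psi (ultra_minorant (dalg R) phi_).
  move=> rho [rho_ [rhoP rho_le [B rhoB] [rhoM rhoE]]] x xM.
  rewrite /psi /corner_weight; case: asboolP => [xe|_]; last exact: leey.
  have lin := pp_linear rhoM.
  have rho0 : rho (fun=> 0) = 0.
    have := lin (-1) _ _ eM.1 eM.1; rewrite mulN1r addNr => <-; congr rho.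
    by apply/funext => k; rewrite scaleN1r addNr.
  have M0 : M (fun=> 0).
    have := vna_linear Mv (-1) eM.1 eM.1; congr M.
    by apply/funext => k; rewrite scaleN1r addNr.
  have rhox : rho x = '[x (atom_vec R w i), atom_vec R w i] * rho (atom R w i).
    rewrite -[RHS]addr0 -[X in _ + X]rho0 -lin //; last exact: eM.1.
    congr rho; apply/funext => k; rewrite addr0 xe atomE.
    exact: (rank_one_minimal Mv Mc v1 Me k xM.1).
  have l0 := xM.2 (atom_vec R w i).
  rewrite rhox -(ge0_ReK l0) ReZ lee_fin mulrC ler_wpM2r ?Re_ge0 //.
  rewrite rhoE; last exact: atom_seqP.
  apply: ulim_Re_le.
    exists B => j; apply: rhoB; first exact: line_proj_in.
    exact: line_proj_norm.
  apply: filterS wC => j /= hj; rewrite -lee_fin; apply: le_trans hj.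
  by apply: rho_le; exact: line_proj_pos.
apply: le_trans (upw_least phi_ultra psiw maj eM) _.
rewrite /psi /corner_weight asboolT.
  by rewrite atom_fix v1 /= mulr1.
by move=> k; rewrite atomE (proj_idem (rank_one_projection v1 Me)).
Qed.

End WeightsOfAtoms.

Section UnboundedWeight.
Variables (R : realType) (w : free_ultrafilter).
Local Notation K := (hilbert_ultraproduct w (dspace R)).
Local Notation M := (groh_raynaud w (dalg R)).

(** The truncation by j only matters for finitely many j. *)
Definition const_index (k j : nat) : 'I_j.+1 := inord (minn k j).

(** Contributes (k + 1)^2 to the value of a sum of vector functionals at the
    k-th atom. *)
Definition scaled_atom (k : nat) : K := k.+1%:R *: atom_vec R w (const_index k).

Lemma atom_vec_orth k l : k != l ->
  '[atom_vec R w (const_index k), atom_vec R w (const_index l)] = 0.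
Proof.
move=> kl; rewrite ultra_vec_dot; [|exact: bounded_seq_basis1..].
apply: ulim_near; apply: filterS (tail_in_ultra w (maxn k l)) => j /=.
rewrite geq_max => /andP[kj lj]; rewrite dot_basis entry_basis.
case: eqP => // /(congr1 (@nat_of_ord _)).
rewrite !inordK ?ltnS ?geq_minr // (minn_idPl kj) (minn_idPl lj).
by move=> e; rewrite e eqxx in kl.
Qed.

Lemma scaled_atoms_separated : separated_family M (range scaled_atom).
Proof.
move=> _ _ [k _ <-] [l _ <-] ne; exists (atom R w (const_index k)).
have kl : l != k by apply/eqP => e; apply: ne; rewrite e.
split; first exact: atom_projection.
  by rewrite /scaled_atom (linZ (vna_lin (ultra_vna R w) (atom_in _ _ _))) atom_fix.
rewrite /scaled_atom (linZ (vna_lin (ultra_vna R w) (atom_in _ _ _))) atomE.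
rewrite /rank_one (atom_vec_orth kl) scale0r; exact: scaler0.
Qed.

Lemma vector_sum_unbounded (S : set K) k : range scaled_atom `<=` S ->
  (k.+1%:R%:E <= vector_sum_weight S (atom R w (const_index k)))%E.
Proof.
move=> sS.
have eM := projection_pos (atom_projection R w (const_index k)).
apply: esum_ge; exists [set scaled_atom k].
  by split; [exact: finite_set1|move=> _ ->; apply: sS; exists k].
rewrite fsbig_set1 lee_fin atomE (rank_one_form (atom_vec R w (const_index k))).
rewrite /scaled_atom dotZl atom_vec1 mulr1 normr_nat -natrX.
rewrite -(rmorph_nat (real_complex R)) /= ler_nat.
by rewrite expnS leq_pmulr.
Qed.

End UnboundedWeight.

Theorem proposition4p18 (R : realType) (w : free_ultrafilter) :
  exists (H_ : nat -> hilbert R) (M_ : forall j, set (H_ j -> H_ j)),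
    (forall j, in_standard_form (M_ j)) /\
    exists phi : (hilbert_ultraproduct w H_ -> hilbert_ultraproduct w H_) -> \bar R,
      nsf_weight (groh_raynaud w M_) phi /\
      forall phi_ : forall j, (H_ j -> H_ j) -> \bar R,
        (forall j, nsf_weight (M_ j) (phi_ j)) ->
        ~ is_ultraproduct_weight w M_ phi_ phi.
Proof.
exists (dspace R), (dalg R); split.
  by move=> j; exists (@conj_vec R j.+1), (@pos_cone R j.+1); exact: diag_standard_form.
have Mv := ultra_vna R w; have Mc := @ultra_commutative R w.
have [S [S0S sepS maxS]] := maximal_separated_family Mv (@scaled_atoms_separated R w).
have nsf := vector_sum_nsf Mv Mc sepS maxS.
exists (vector_sum_weight S); split=> // phi_ phi_nsf phi_ultra.
have phi_w j : weight (dalg R j) (phi_ j) := nsf_is_weight (phi_nsf j).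
(* The line of largest weight in each factor: its atom is at least as heavy as
   every other atom for the ultraproduct of these weights. *)
pose best j : 'I_j.+1 :=
  [arg max_(k > ord0 | true) (phi_ j (line_proj k))]%O.
have bestP j k : (phi_ j (line_proj k) <= phi_ j (line_proj (best j)))%E.
  by rewrite /best; case: arg_maxP => // l _ h; exact: h.
have eM := projection_pos (atom_projection R w best).
have fin : (vector_sum_weight S (atom R w best) < +oo)%E.
  rewrite atomE; apply: (nsf_rank_one_finite Mv Mc _ _ nsf); first exact: atom_vec1.
  by rewrite -atomE; exact: atom_in.
have ge0 := weight_ge0 (nsf_is_weight nsf) eM.
have [c c0 cE] : exists2 c : R, 0 <= c & vector_sum_weight S (atom R w best) = c%:E.
  by move: fin ge0; case: (vector_sum_weight S _) => [c _ c0|//|//]; exists c.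
have c1 : 0 <= c + 1 by rewrite addr_ge0.
have wC : fu_sets w [set j | (phi_ j (line_proj (best j)) <= (c + 1)%:E)%E].
  have [h|h] := in_ultra_setVsetC
    [set j | ((c + 1)%:E <= phi_ j (line_proj (best j)))%E] (fu_ultra w).
    have := weight_atom_ge phi_w phi_ultra c1 h.
    by rewrite cE lee_fin leNgt ltrDl ltr01.
  by apply: filterS h => j /= /negP; rewrite -ltNge => /ltW.
have bound k : k.+1%:R <= c + 1.
  rewrite -lee_fin; apply: le_trans (vector_sum_unbounded k S0S) _.
  apply: (weight_atom_le phi_ultra c1); apply: filterS wC => j /=.
  exact: le_trans.
have := bound (Num.truncn (c + 1)); rewrite leNgt => /negP; apply.
exact: truncnS_gt.
Qed.
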